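(* Let $p$ be an odd prime. Then $$\sum_{k=0}^{(p-1)/2}\binom{2k}{k}\frac{T_{2k}(12,-7)}{16^k}\equiv\begin{cases}2x\left(\frac{x}{7}\right)\pmod p&\text{if }\left(\frac{p}{7}\right)=1\text{ and }p=x^2+7y^2\text{ with }x,y\in\mathbb{Z},\\ 0\pmod p&\text{if }\left(\frac{p}{7}\right)=-1.\end{cases}$$
   Context: For integers $b,c$ and $n\ge0$, $T_n(b,c)$ is the coefficient of $x^n$ in $(x^2+bx+c)^n$, i.e. $T_n(b,c)=\sum_{j=0}^{\lfloor n/2\rfloor}\binom{n}{2j}\binom{2j}{j}b^{n-2j}c^j$. The symbol $\left(\frac{\cdot}{7}\right)$ is the Legendre symbol modulo $7$. The congruence modulo $p$ is between rational numbers whose denominators are prime to $p$. *)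

(* Defs.v *)
From HB Require Import structures.
From mathcomp Require Import all_boot all_order all_algebra.
Set Implicit Arguments.
Unset Strict Implicit.
Unset Printing Implicit Defensive.
Import Order.TTheory GRing.Theory Num.Theory.
Local Open Scope ring_scope.

(* Generalized central trinomial coefficient T_n(b, c). *)
Definition trinomial (n : nat) (b c : int) : int :=
  (('X^2 + b *: 'X + c%:P) ^+ n : {poly int})`_n.

(* Legendre symbol (a / p); only meaningful for p an odd prime. *)
Definition legendre (a : int) (p : nat) : int :=
  if (p%:Z %| a)%Z then 0
  else if [exists z : 'I_p, (z%:Z ^+ 2 == a %[mod p%:Z])%Z] then 1
  else -1.

(* Congruence modulo m between rationals whose denominators are prime to m. *)
Definition eqmodq (m : nat) (r s : rat) : Prop :=
  [/\ coprimez m%:Z (denq r), coprimez m%:Z (denq s)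
    & (m%:Z %| numq (r - s))%Z].

(* Main.v *)
Require Import Defs.
From HB Require Import structures.
From mathcomp Require Import all_boot all_order all_algebra.
From mathcomp Require Import all_fingroup all_solvable all_field.
From mathcomp Require Import ring zify.
Set Implicit Arguments.
Unset Strict Implicit.
Unset Printing Implicit Defensive.
Import Order.TTheory GRing.Theory Num.Theory.
Local Open Scope ring_scope.

(** Put n = (p - 1) / 2 and compute modulo p.

    Since binomial (2k, k) = (-4)^k binomial (n, k), both for the factor in
    front of T_2k and for the central binomials inside T_2k, the sum S is the
    coefficient of u^(p-1) in G^n, where G = (1 - (u + 12)^2 / 4) (u^2 + 28)
    ([trinomial_sum_coef]).  This is the Hasse invariant of the genus one curve
    v^2 = G(u), which has complex multiplication by sqrt(-7).

    The curve is a quotient of Klein's quartic by a cyclic permutation of the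
    coordinates, hence of the Fermat-type curve r^7 (1 - z^7) = 1, and its
    invariant differential pulls back to (r^5 - z r^3 + z^3 r^6) dz.  The
    coefficient of z^(p-1) dz in that differential is the Hasse invariant again,
    because all powers of u other than u^(p-1) contribute exact differentials
    ([coef_comp_deriv], [hasse_klein_form]).  As r is a series in z^7, the
    coefficient vanishes unless p - 1 is 0, 1 or 3 modulo 7, that is, unless p
    is a square modulo 7, and then it is a binomial coefficient up to sign
    ([hasse_value]).

    It remains to evaluate that binomial coefficient by a sum of 7th roots of
    unity, as Jacobi and Eisenstein did.  For p = 1 mod 7 this is the Jacobi sum
    of a character of order 7 along the line x + y + 1 = 0; for p = 2, 4 mod 7 it
    is the sum of a character of order 7 along Singer's difference set in the
    cyclic group of order p^2 + p + 1 inside the field of p^3 elements.  In both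
    cases a symmetry puts the sum in the quadratic subfield, so that it is
    u + w sqrt(-7); a count of ratios shows that its norm is p; a power sum
    computes it modulo a prime above p; and the number of its terms gives u
    modulo 7 ([septic_periods], [split_periods], [singer_periods]).  So the
    Hasse invariant is -2u with p = u^2 + 7 w^2 and u a nonresidue modulo 7.
    Representations of p by that form are unique up to signs ([form7_unique]),
    hence u = x or u = -x, and -2u = 2x (x/7) in either case. *)

(** * Binomial coefficients in characteristic p *)

Lemma natr_ffact (R : nzRingType) (a k : nat) :
  (a ^_ k)%:R = \prod_(i < k) (a%:R - i%:R) :> R.
Proof.
elim: k => [|k IHk]; first by rewrite big_ord0.
rewrite ffactnSr natrM big_ord_recr /= IHk.
have [lt_ak | le_ka] := ltnP a k; last by rewrite natrB.
have -> : \prod_(i < k) (a%:R - i%:R) = 0 :> R by rewrite -IHk ffact_small.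
by rewrite !mul0r.
Qed.

Lemma exprD_pchar (R : comNzRingType) (p : nat) (x y : R) :
  p \in [pchar R] -> (x + y) ^+ p = x ^+ p + y ^+ p.
Proof. by move=> charRp; rewrite exprDn_pchar // pnatE // (pcharf_prime charRp). Qed.

Section CharP.
Variables (F : fieldType) (p : nat).
Hypotheses (p_prime : prime p) (charFp : p \in [pchar F]).

Lemma natr_eq0_pchar (m : nat) : (m%:R == 0 :> F) = (p %| m)%N.
Proof. by rewrite (dvdn_pcharf charFp). Qed.

Lemma intr_eq0_pchar (m : int) : (m%:~R == 0 :> F) = (p%:Z %| m)%Z.
Proof.
case: m => m; first by rewrite -pmulrn natr_eq0_pchar dvdzE.
by rewrite NegzE mulrNz oppr_eq0 -pmulrn natr_eq0_pchar dvdzE abszN.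
Qed.

Lemma two_neq0_pchar : odd p -> 2%:R != 0 :> F.
Proof.
move=> p_odd; rewrite natr_eq0_pchar dvdn_prime2 //.
by apply: contraTneq p_odd => ->.
Qed.

Lemma fact_neq0_pchar (k : nat) : (k < p)%N -> (k`!)%:R != 0 :> F.
Proof.
elim: k => [|k IHk] lt_kp; first by rewrite oner_eq0.
rewrite factS natrM mulf_neq0 ?IHk 1?ltnW //.
by rewrite natr_eq0_pchar; apply: contraL lt_kp => /dvdn_leq; rewrite -leqNgt; apply.
Qed.

Lemma natr_bin (a k : nat) : (k < p)%N ->
  'C(a, k)%:R = (\prod_(i < k) (a%:R - i%:R)) / (k`!)%:R :> F.
Proof.
move=> lt_kp; rewrite -natr_ffact -bin_ffact natrM mulfK //.
exact: fact_neq0_pchar.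
Qed.

(** As a function of a, binomial (a, k) is a polynomial with denominator k!, and
    the change of variable from a to k - 1 - a reverses the order of its k
    factors, changing the sign of each. *)
Lemma bin_reflect (a b k : nat) : (k < p)%N -> (a + b).+1%:R = k%:R :> F ->
  'C(a, k)%:R = (-1) ^+ k * 'C(b, k)%:R :> F.
Proof.
move=> lt_kp eq_abk; rewrite !natr_bin // mulrA; congr (_ / _).
have -> : (-1) ^+ k = \prod_(i < k) (-1 : F) by rewrite prodr_const card_ord.
rewrite -big_split /= (reindex_inj rev_ord_inj); apply: eq_bigr => i _ /=.
have lt_ik := ltn_ord i; rewrite natrB //.
have -> : k%:R = a%:R + b%:R + 1 :> F by rewrite -eq_abk -addn1 !natrD.
by rewrite -addn1 natrD; ring.
Qed.

Lemma bin_pred_prime (k : nat) : (k < p)%N -> 'C(p.-1, k)%:R = (-1) ^+ k :> F.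
Proof.
move=> lt_kp; rewrite (bin_reflect (b := k)) ?binn ?mulr1 //.
rewrite -addSn prednK ?prime_gt0 // natrD.
have /eqP-> : p%:R == 0 :> F by rewrite natr_eq0_pchar.
by rewrite add0r.
Qed.

(** The n in the binomial on the right behaves like -1/2, and binomial (2j, j) is
    (-4)^j times the binomial coefficient of -1/2 over j. *)
Lemma bin_central (n j : nat) : p = n.*2.+1 -> (j <= n)%N ->
  'C(j.*2, j)%:R = (- 4%:R) ^+ j * 'C(n, j)%:R :> F.
Proof.
move=> def_p; elim: j => [|j IHj] le_jn; first by rewrite !bin0 mulr1.
have j1_neq0 : j.+1%:R != 0 :> F.
  by rewrite natr_eq0_pchar gtnNdvd //; lia.
have p0 : n%:R *+ 2 + 1 = 0 :> F.
  by apply/eqP; rewrite -mulrnA natr1 natr_eq0_pchar muln2 -def_p.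
apply: (mulfI j1_neq0); rewrite -natrM.
have -> : (j.+1 * 'C(j.+1.*2, j.+1) = 2 * (j.*2.+1 * 'C(j.*2, j)))%N.
  rewrite doubleS mul_bin_diag mulnC /=.
  have := mul_bin_left j.*2.+1 j; rewrite -mul_bin_diag.
  have -> : (j.*2.+1 - j = j.+1)%N by lia.
  have := mul_bin_down j.*2 j; have := mul_bin_diag j.*2.+1 j.
  have := binS j.*2.+1 j; lia.
rewrite natrM natrM IHj ?(ltnW le_jn) // exprS.
have /(congr1 (fun x : nat => x%:R : F)) := mul_bin_left n j.
rewrite !natrM natrB 1?ltnW // => eqC.
have -> : j.+1%:R * (- 4%:R * (- 4%:R) ^+ j * 'C(n, j.+1)%:R) =
  - 4%:R * (- 4%:R) ^+ j * (j.+1%:R * 'C(n, j.+1)%:R) :> F by ring.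
have -> : j.*2.+1%:R = 2 * j%:R + 1 :> F by rewrite -natrM natr1 mul2n.
rewrite eqC; apply/eqP; rewrite -subr_eq0; apply/eqP.
transitivity ((- 4%:R) ^+ j * 'C(n, j)%:R * 2 * (n%:R *+ 2 + 1) : F); first by ring.
by rewrite p0 mulr0.
Qed.
End CharP.

(** * The sum as a Hasse invariant *)

Lemma coef_binomial (R : comNzRingType) (a c : R) (d N k : nat) :
  (((c%:P + a *: 'X^(d.+1)) ^+ N)`_k =
   if (d.+1 %| k)%N then 'C(N, k %/ d.+1)%:R * c ^+ (N - k %/ d.+1) * a ^+ (k %/ d.+1)
   else 0).
Proof.
rewrite exprDn coef_sum.
have coefE i : (c%:P ^+ (N - i) * (a *: 'X^(d.+1)) ^+ i *+ 'C(N, i))`_k =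
    if k == (d.+1 * i)%N then 'C(N, i)%:R * c ^+ (N - i) * a ^+ i else 0.
  rewrite coefMn -rmorphXn /= mul_polyC exprZn -exprM !coefZ coefXn.
  by case: eqP => _; rewrite ?mulr0 ?mul0rn // mulr1 -mulrA mulr_natl.
under eq_bigr do rewrite coefE.
case: ifPn => [/dvdnP[q ->]|ndvd].
  rewrite mulnK //.
  have [lt_qN | le_Nq] := ltnP q N.+1.
    rewrite (bigD1 (Ordinal lt_qN)) //= mulnC eqxx big1 ?addr0 // => i /eqP ne_iq.
    by case: eqP => // /eqP; rewrite eqn_pmul2l // => /eqP eq_qi; case: ne_iq; apply: val_inj.
  rewrite bin_small // !mul0r big1 // => i _.
  by case: eqP => // /eqP; rewrite mulnC eqn_pmul2l // => /eqP eq_qi; have := ltn_ord i; lia.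
by rewrite big1 // => i _; case: eqP ndvd => // ->; rewrite dvdn_mulr.
Qed.

Lemma coef_trinomial (R : comNzRingType) (b c : R) (m : nat) :
  (('X^2 + b *: 'X + c%:P) ^+ m)`_m =
  \sum_(i < m.+1) 'C(m, i)%:R * b ^+ (m - i) * (('X^2 + c%:P) ^+ i)`_i.
Proof.
rewrite [X in X ^+ m](_ : _ = b *: 'X + ('X^2 + c%:P)); last by rewrite addrAC addrC.
rewrite exprDn coef_sum; apply: eq_bigr => i _.
have le_im : (i <= m)%N by rewrite -ltnS.
rewrite coefMn exprZn -scalerAl coefZ coefXnM ltnNge leq_subr /= subKn //.
by rewrite -mulrA mulr_natl.
Qed.

(** The first factor comes from summing over k.  The second, u^2 + 28, is the
    discriminant of x^2 - u x - 7, whose roots solve u = x - 7 / x; here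
    x + 12 - 7 / x is x^2 + 12 x - 7 divided by x. *)
Definition quartic (F : fieldType) : {poly F} :=
  (1 - 4%:R^-1 *: ('X + 12%:R%:P) ^+ 2) * ('X^2 + 28%:R%:P).

Section HasseSum.
Variables (F : fieldType) (p n : nat).
Hypotheses (p_prime : prime p) (charFp : p \in [pchar F]) (def_p : p = n.*2.+1).

Let two_neq0 : 2%:R != 0 :> F.
Proof. by apply: (two_neq0_pchar p_prime charFp); rewrite def_p /= odd_double. Qed.

(** For odd i both sides vanish; for i = 2j they are binomial (2j, j) (-7)^j and
    binomial (n, j) 28^j, which [bin_central] identifies. *)
Lemma trinomial_pairing (i : nat) : (i <= n.*2)%N ->
  (('X^2 + (- 7%:R)%:P) ^+ i)`_i = (('X^2 + 28%:R%:P) ^+ n)`_(n.*2 - i) :> F.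
Proof.
move=> le_i.
have X2E (c : F) : 'X^2 + c%:P = c%:P + 1 *: 'X^2 by rewrite scale1r addrC.
rewrite !X2E !coef_binomial !expr1n !mulr1 !dvdn2 oddB // odd_double addFb.
case: ifPn => // i_even; rewrite !divn2.
have [j def_i] : {j | i = j.*2} by exists i./2; rewrite even_halfK.
rewrite def_i leq_double -doubleB !doubleK in le_i *.
have -> : (j.*2 - j = j)%N by lia.
rewrite (bin_central p_prime charFp def_p) // bin_sub // subKn //.
rewrite mulrAC -exprMn_comm; last exact: mulrC.
have -> : - 4%:R * - 7%:R = 28%:R :> F by rewrite mulrNN -natrM.
by rewrite mulrC.
Qed.

(** By [trinomial_pairing], T_2k is the coefficient of u^(2n) in
    (u + 12)^(2k) (u^2 + 28)^n; the binomial theorem then performs the sum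
    over k. *)
Lemma trinomial_sum_coef :
  \sum_(k < n.+1) 'C(k.*2, k)%:R * (trinomial k.*2 12 (- 7))%:~R / 16%:R ^+ k =
  (quartic F ^+ n)`_(n.*2).
Proof.
rewrite exprMn [in RHS]exprDn mulr_suml coef_sum; apply: eq_bigr => k _.
have le_kn : (k <= n)%N by rewrite -ltnS.
rewrite expr1n mul1r [in RHS]mulrnAl coefMn -scaleNr exprZn -exprM -scalerAl coefZ.
have -> : (trinomial k.*2 12 (- 7))%:~R =
    (('X^2 + 12%:R *: 'X + (- 7%:R)%:P) ^+ k.*2)`_(k.*2) :> F.
  rewrite /trinomial -coef_map rmorphXn /= !rmorphD /= map_polyXn map_polyZ map_polyX map_polyC /=.
  by rewrite rmorphN.
have -> : (('X + 12%:R%:P) ^+ (2 * k) * ('X^2 + 28%:R%:P) ^+ n)`_(n.*2) =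
    (('X^2 + 12%:R *: 'X + (- 7%:R)%:P) ^+ k.*2)`_(k.*2) :> F.
  rewrite coef_trinomial mul2n ['X + _]addrC exprDn mulr_suml coef_sum.
  apply: eq_bigr => i _.
  have le_ik : (i <= k.*2)%N by rewrite -ltnS.
  rewrite trinomial_pairing; last by lia.
  rewrite -rmorphXn /= [in LHS]mulrnAl coefMn -!mulrA coefCM coefXnM.
  rewrite ltnNge (leq_trans le_ik) ?leq_double //=.
  by rewrite mulr_natl.
rewrite (bin_central p_prime charFp def_p) // -[_ *+ 'C(n, k)]mulr_natl.
have -> : (- 4%:R^-1) ^+ k = (- 4%:R) ^+ k / 16%:R ^+ k :> F.
  rewrite -expr_div_n; congr (_ ^+ k).
  have -> : 16%:R = 4%:R * 4%:R :> F by rewrite -natrM.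
  have : 4%:R != 0 :> F by rewrite (natrM _ 2 2) mulf_neq0.
  by move=> n4; rewrite invfM mulrA mulNr divff // mulN1r.
by ring.
Qed.
End HasseSum.

(** * Exact differentials in characteristic p *)

Definition agree (R : nzRingType) (k : nat) (P Q : {poly R}) :=
  forall i, (i < k)%N -> P`_i = Q`_i.

Section Agree.
Variables (R : comNzRingType) (k : nat).
Implicit Types P Q : {poly R}.

Lemma agree_refl P : agree k P P. Proof. by []. Qed.

Lemma agree_sym P Q : agree k P Q -> agree k Q P.
Proof. by move=> PQ i lt_ik; rewrite PQ. Qed.

Lemma agree_trans Q P S : agree k P Q -> agree k Q S -> agree k P S.
Proof. by move=> PQ QS i lt_ik; rewrite PQ ?QS. Qed.

Lemma agreeM P Q P' Q' : agree k P Q -> agree k P' Q' -> agree k (P * P') (Q * Q').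
Proof.
move=> PQ PQ' i lt_ik; rewrite !coefM; apply: eq_bigr => j _.
by rewrite PQ ?PQ' //; have := ltn_ord j; lia.
Qed.

Lemma agreeX P Q n : agree k P Q -> agree k (P ^+ n) (Q ^+ n).
Proof. by move=> PQ; elim: n => // n IHn; rewrite !exprS; apply: agreeM. Qed.

(** The form in which an identity that holds modulo a relation S is used: the
    cofactor T makes it an identity of polynomials. *)
Lemma agree_subM P Q S T : agree k S 0 -> P - Q = S * T -> agree k P Q.
Proof.
move=> S0 eqPQ; rewrite -[P](subrK Q) eqPQ => i lt_ik.
by rewrite coefD (agreeM S0 (agree_refl T)) // mul0r coef0 add0r.
Qed.

Lemma agree_Xn n P : (k <= n)%N -> agree k ('X^n * P) 0.
Proof. by move=> le_kn i lt_ik; rewrite coefXnM (leq_trans lt_ik) ?coef0. Qed.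
End Agree.

Section Cartier.
Variables (F : fieldType) (p : nat).
Hypotheses (p_prime : prime p) (charFp : p \in [pchar F]).
Implicit Types P Q : {poly F}.

Lemma natr_exp_pchar (a : nat) : (a%:R : F) ^+ p = a%:R.
Proof. by rewrite -(pFrobenius_autE charFp) pFrobenius_aut_nat. Qed.

Lemma coef_deriv_pchar P j : (0 < j)%N -> (P^`())`_((j * p).-1) = 0.
Proof.
move=> j_gt0; rewrite coef_deriv prednK ?muln_gt0 ?j_gt0 ?prime_gt0 //.
by rewrite mulrnA -mulr_natr (pcharf0 charFp) mulr0.
Qed.

(** P^k P' is the derivative of P^(k+1) / (k+1), and a derivative has no term of
    degree -1 modulo p. *)
Lemma coef_exp_deriv P k j : (0 < j)%N -> k.+1%:R != 0 :> F ->
  (P ^+ k * P^`())`_((j * p).-1) = 0.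
Proof.
move=> j_gt0 k1_neq0; apply: (mulfI k1_neq0); rewrite mulr0 mulr_natl -coefMn.
by rewrite mulrC -[k]/(k.+1.-1) -deriv_exp coef_deriv_pchar.
Qed.

(** Among the monomials of H only u^(p-1) gives a differential u^k du that is
    not exact.  The parameter u is ramified of order 2 at z = 0, so the residue
    class of degrees to look at is reached first in degree 2p - 1.  Replacing u
    by u - c changes u^(p-1) du by exact differentials, whence the absence of c
    on the right. *)
Lemma coef_comp_deriv (H : {poly F}) c Q : (size H <= (p.-1).*2.+1)%N ->
  let u := c%:P + 'X^2 * Q in
  ((H \Po u) * u^`())`_((2 * p).-1) = H`_p.-1 * (2%:R * Q`_0 ^+ p).
Proof.
move=> sizeH u; have p_gt1 := prime_gt1 p_prime.
have natr_neq0 k : (0 < k < p.*2)%N -> k != p -> k%:R != 0 :> F.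
  move=> /andP[k_gt0 lt_k] ne_kp; rewrite (natr_eq0_pchar charFp).
  apply: contra ne_kp => /dvdnP[[|[|q]] def_k]; first by lia.
    by rewrite def_k mul1n.
  have : (q.+2 * p = p + p + q * p)%N by lia.
  by lia.
have top : (u ^+ p.-1 * u^`())`_((2 * p).-1) = 2%:R * Q`_0 ^+ p.
  have -> : u^`() = ('X^2 * Q)^`() by rewrite /u derivD derivC add0r.
  rewrite exprDn mulr_suml coef_sum big_ord_recr /= subnn expr0 mul1r binn mulr1n.
  rewrite big1 ?add0r => [|j _]; last first.
    have lt_jp := ltn_ord j.
    rewrite mulrnAl coefMn -rmorphXn /= -mulrA coefCM coef_exp_deriv ?mulr0 ?mul0rn //.
    by apply: natr_neq0; lia.
  have -> : ('X^2 * Q) ^+ p.-1 * ('X^2 * Q)^`() =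
      'X^((2 * p).-1) * (2%:R *: Q ^+ p + 'X * (Q ^+ p.-1 * Q^`())).
    rewrite derivM derivXn /= exprMn -exprM -[in Q ^+ p](prednK (prime_gt0 p_prime)) exprS.
    have -> : ((2 * p).-1 = 2 * p.-1 + 1)%N by lia.
    rewrite exprD scaler_nat expr0 expr1 mulr1 [Q ^+ p.-1.+1]exprS.
    by move: (Q ^+ p.-1) 'X^(2 * p.-1) => A B; ring.
  rewrite coefXnM ltnn subnn coefD coefZ coefXM eqxx addr0.
  by rewrite -!horner_coef0 horner_exp.
rewrite comp_polyE mulr_suml coef_sum.
have coefE i : (i < size H)%N -> i != p.-1 ->
    (H`_i *: u ^+ i * u^`())`_((2 * p).-1) = 0.
  move=> lt_i ne_i; rewrite -scalerAl coefZ coef_exp_deriv ?mulr0 //.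
  by apply: natr_neq0; lia.
have [lt_pH | le_Hp] := ltnP p.-1 (size H).
  rewrite (bigD1 (Ordinal lt_pH)) //= big1 ?addr0 => [|i ne_i]; last exact: coefE.
  by rewrite -scalerAl coefZ top.
rewrite big1 => [|i _]; first by rewrite nth_default // mul0r.
by apply: coefE => //; have := ltn_ord i; lia.
Qed.
End Cartier.

(** * The cover by the curve r^7 (1 - z^7) = 1 *)

Section KleinCurve.
Variable R : comNzRingType.
Variables z r s : R.
(** Klein's quartic X^3 Y + Y^3 Z + Z^3 X = 0 has the point
    (z^3 r : - z / r^2 : 1) when r^7 (1 - z^7) = 1.  For
    t = - (Y/X + Z/Y + X/Z) - 1, which is invariant under the cyclic permutation
    of the coordinates, 1/t = klein_num / (klein_den - 2 klein_num), and
    u = -10 - 8 klein_num / klein_den is the coordinate of the quartic curve. *)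
Definition klein_num : R := z ^+ 2 * r ^+ 3.
Definition klein_den : R := 1 + z * r ^+ 5 - z ^+ 5 * r ^+ 4 + z ^+ 2 * r ^+ 3.
(** z * klein_y / klein_den^2 is, up to a factor 16, a square root of the quartic
    at u, and klein_form dz is, up to a constant, its invariant differential. *)
Definition klein_y : R :=
  2%:R * r ^+ 5 + 3%:R * z * r ^+ 3 + 3%:R * z ^+ 2 * r ^+ 8 + z ^+ 3 * r ^+ 6
  - 2%:R * z ^+ 4 * r ^+ 4 - 2%:R * z ^+ 5 * r ^+ 9 - 3%:R * z ^+ 6 * r ^+ 7.
Definition klein_form : R := r ^+ 5 - z * r ^+ 3 + z ^+ 3 * r ^+ 6.

Let eps := r ^+ 7 - z ^+ 7 * r ^+ 7 - 1.

(** The equation of the quartic curve, cleared of denominators; it holds because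
    the right side is a multiple of the defining relation eps of the cover. *)
Lemma klein_curve :
  (z * klein_y) ^+ 2 - klein_num * (klein_den - 2%:R * klein_num) *
     (4%:R * klein_den ^+ 2 + 5%:R * klein_num * klein_den + 2%:R * klein_num ^+ 2) =
  eps * (4%:R * z ^+ 2 * r ^+ 3 - 4%:R * z ^+ 5 * r ^+ 11 - 4%:R * z ^+ 10 * r ^+ 8).
Proof. rewrite /eps /klein_y /klein_num /klein_den; ring. Qed.

(** The left side expands klein_num' * klein_den - klein_num * klein_den' by the
    product rule, s standing for the derivative of r; the relation
    r^7 (1 - z^7) = 1 gives s = z^6 r^8. *)
Lemma klein_differential :
  (2%:R * z * r ^+ 3 + z ^+ 2 * (3%:R * r ^+ 2 * s)) * klein_den
   - klein_num * (r ^+ 5 + z * (5%:R * r ^+ 4 * s)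
      - (5%:R * z ^+ 4 * r ^+ 4 + z ^+ 5 * (4%:R * r ^+ 3 * s))
      + (2%:R * z * r ^+ 3 + z ^+ 2 * (3%:R * r ^+ 2 * s)))
   - z * klein_y * klein_form =
  (s - z ^+ 6 * r ^+ 8) * (3%:R * z ^+ 2 * r ^+ 2 - 2%:R * z ^+ 3 * r ^+ 7 + z ^+ 7 * r ^+ 6)
  + eps * (- 2%:R * z * r ^+ 3 - 3%:R * z ^+ 3 * r ^+ 6 - z ^+ 6 * r ^+ 7).
Proof. rewrite /eps /klein_y /klein_form /klein_num /klein_den; ring. Qed.
End KleinCurve.

Section Hasse.
Variables (F : fieldType) (p n m : nat).
Hypotheses (p_prime : prime p) (charFp : p \in [pchar F]) (def_p : p = n.*2.+1).
Hypothesis m7 : (7 * m).+1%:R = 0 :> F.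

(* As m is -1/7 modulo p, the polynomial r is the power series of
   (1 - z^7)^(-1/7) up to degree 7p. *)
Let r : {poly F} := (1 - 'X^7) ^+ m.
Let s := r^`().
Let w := klein_form 'X r.
Let y0 := klein_y 'X r.
Let N := klein_num 'X r.
Let b := klein_den 'X r.
(* The inverse of b up to degree p^2, because b has constant term 1. *)
Let beta := b ^+ (p ^ 2).-1.
Let eps := r ^+ 7 - 'X ^+ 7 * r ^+ 7 - 1.

Let two_neq0 : 2%:R != 0 :> F.
Proof. by apply: (two_neq0_pchar p_prime charFp); rewrite def_p /= odd_double. Qed.

Let p_gt2 : (2 < p)%N.
Proof. by case: n def_p p_prime => [|[|k]] ->. Qed.

Let charPp : p \in [pchar {poly F}]. Proof. by rewrite pchar_poly. Qed.

Let exprDp (P Q : {poly F}) j : (P + Q) ^+ (p ^ j) = P ^+ (p ^ j) + Q ^+ (p ^ j).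
Proof.
elim: j => // j IHj; rewrite expnSr !exprM IHj.
exact: exprD_pchar charPp.
Qed.

Let eps0 : agree (2 * p) eps 0.
Proof.
have [k def_k] : exists k, (7 * m).+1 = (p * k)%N.
  have /eqP := m7; rewrite (natr_eq0_pchar charFp) => /dvdnP[k ->].
  by exists k; rewrite mulnC.
have -> : eps = (1 + (- 'X^7) ^+ p) ^+ k - 1.
  have -> : 1 + (- 'X^7) ^+ p = (1 - 'X^7) ^+ p :> {poly F}.
    by rewrite (exprD_pchar _ _ charPp) expr1n.
  by rewrite -exprM -def_k exprS mulnC exprM -/r /eps; ring.
have one : agree (2 * p) (1 + (- 'X^7) ^+ p) (1 : {poly F}).
  apply: (@agree_subM _ _ _ _ ('X^(2 * p) * 'X^(5 * p)) ((-1) ^+ p)).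
    exact: agree_Xn.
  rewrite -exprD -mulnDl addrAC subrr add0r [(- 'X^7) ^+ p]exprNn -exprM mulrC.
  by [].
move=> i lt_i; rewrite coefB (agreeX k one) // expr1n.
by rewrite subrr coef0.
Qed.

Let s_eq : agree (2 * p) (s - 'X ^+ 6 * r ^+ 8) 0.
Proof.
have s_deriv : (1 - 'X^7) * s = 'X^6 * r.
  rewrite /s /r; case: m m7 => [/eqP|k k7]; first by rewrite oner_eq0.
  rewrite deriv_exp derivB derivXn derivC sub0r /=.
  have k7' : (k.+1 * 7)%:R = - 1 :> {poly F}.
    have : (7 * k.+1).+1%:R%:P = 0 :> {poly F} by rewrite k7.
    by rewrite -natr1 polyCD polyC1 polyC_natr mulnC => /eqP; rewrite addr_eq0 => /eqP.
  rewrite [(1 - 'X^7) ^+ k.+1]exprS mulrCA; congr (_ * _).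
  by rewrite -mulr_natr -[_ *+ 7]mulr_natr mulrAC mulNr -mulrA -natrM mulnC k7' mulrN1 opprK.
apply: agree_trans (_ : agree _ (eps * - s) _).
  suff -> : s - 'X ^+ 6 * r ^+ 8 = eps * - s by [].
  have -> : 'X ^+ 6 * r ^+ 8 = r ^+ 7 * ('X^6 * r) by ring.
  by rewrite -s_deriv /eps; ring.
by move=> i lt_i; rewrite (agreeM eps0 (agree_refl _)) // mul0r.
Qed.

Let b_split : exists Q, b = 1 + 'X * Q.
Proof.
exists (r ^+ 5 - 'X ^+ 4 * r ^+ 4 + 'X * r ^+ 3).
by rewrite /b /klein_den; ring.
Qed.

Let b_beta : agree (2 * p) (b * beta) 1.
Proof.
rewrite /beta -exprS prednK ?expn_gt0 ?prime_gt0 //.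
have [Q ->] := b_split.
rewrite exprDp expr1n exprMn.
apply: (@agree_subM _ _ _ _ ('X^(p ^ 2) : {poly F}) (Q ^+ (p ^ 2))).
  by rewrite -['X^_]mulr1; apply: agree_Xn; rewrite expnS expn1 leq_mul // ltnW.
by rewrite addrAC subrr add0r.
Qed.

Let eta : {poly F} := (- 8%:R)%:P * (r ^+ 3 * beta).
Let u : {poly F} := (- 10%:R)%:P + 'X^2 * eta.

Let deriv_u : b * u^`() = (- 8%:R)%:P * (beta * ('X * y0 * w))
  + (- 8%:R)%:P * beta * (N^`() * b - N * b^`() - 'X * y0 * w).
Proof.
have bb : b * beta^`() = - (beta * b^`()).
  rewrite /beta deriv_exp -mulrnAl mulrCA -exprS mulrnAl.
  have p21 : (p ^ 2).-1 = (p ^ 2).-2.+1 by lia.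
  rewrite -p21 -mulr_natl; have -> : (p ^ 2).-1%:R = -1 :> {poly F}.
    apply/eqP; rewrite -addr_eq0 natr1 prednK ?expn_gt0 ?prime_gt0 //.
    by rewrite natrX (pcharf0 charPp) expr0n.
  by rewrite mulN1r mulrC.
have -> : u = (- 10%:R)%:P + (- 8%:R)%:P * (N * beta).
  by rewrite /u /eta /N /klein_num; ring.
rewrite derivD derivC add0r deriv_mulC derivM.
transitivity ((- 8%:R)%:P * (N^`() * b * beta + N * (b * beta^`()))); first by ring.
by rewrite bb; ring.
Qed.

Let differential : agree (2 * p) (N^`() * b - N * b^`() - 'X * y0 * w) 0.
Proof.
have dXr i j : ('X ^+ i.+1 * r ^+ j.+1)^`() =
    i.+1%:R * 'X ^+ i * r ^+ j.+1 + 'X ^+ i.+1 * (j.+1%:R * r ^+ j * s).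
  rewrite derivM derivXn deriv_exp /= -/s -[_ *+ i.+1]mulr_natl -[_ *+ j.+1]mulr_natl.
  by rewrite [s * _]mulrC !mulrA.
have -> : N^`() = 2%:R * 'X * r ^+ 3 + 'X ^+ 2 * (3%:R * r ^+ 2 * s).
  by rewrite /N /klein_num dXr expr1.
have -> : b^`() = r ^+ 5 + 'X * (5%:R * r ^+ 4 * s)
      - (5%:R * 'X ^+ 4 * r ^+ 4 + 'X ^+ 5 * (4%:R * r ^+ 3 * s))
      + (2%:R * 'X * r ^+ 3 + 'X ^+ 2 * (3%:R * r ^+ 2 * s)).
  rewrite /b /klein_den derivD derivB derivD derivC -[in 'X * r ^+ 5](expr1 'X) !dXr.
  by ring.
rewrite klein_differential => i lt_i; rewrite coefD.
rewrite (agreeM s_eq (agree_refl _)) // (agreeM eps0 (agree_refl _)) //.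
by rewrite !mul0r !coef0 addr0.
Qed.

Let quartic_u : agree (2 * p) (quartic F \Po u) (256%:R * ('X * y0 * beta ^+ 2) ^+ 2).
Proof.
pose t := N * beta.
have n4 : 4%:R != 0 :> F by rewrite (natrM _ 2 2) mulf_neq0.
have q4 : (4%:R^-1)%:P * 4%:R = 1 :> {poly F}.
  by rewrite -(polyC_natr _ 4) -polyCM mulVf.
have -> : quartic F \Po u = 256%:R * (t * (1 - 2%:R * t) * (4%:R + 5%:R * t + 2%:R * t ^+ 2)).
  have -> : quartic F \Po u =
      (1 - (4%:R^-1)%:P * (u + 12%:R) ^+ 2) * (u ^+ 2 + 28%:R).
    rewrite /quartic comp_polyM comp_polyB comp_polyZ comp_polyD comp_polyC.
    rewrite !rmorphXn /= comp_polyD !comp_polyC comp_polyX -mul_polyC.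
    by rewrite !polyC_natr.
  have -> : u = - 10%:R + - 8%:R * t.
    by rewrite /u /eta /t /N /klein_num !polyCN !polyC_natr; ring.
  transitivity ((1 - (4%:R^-1)%:P * 4%:R * (1 - 4%:R * t) ^+ 2) * ((- 10%:R + - 8%:R * t) ^+ 2 + 28%:R)).
    by ring.
  by rewrite q4; ring.
have base : agree (2 * p) (b * beta - 1) 0.
  by move=> i lt_i; rewrite coefB b_beta // subrr coef0.
pose x := b * beta.
have step1 : agree (2 * p) (256%:R * (t * (x - 2%:R * t) * (4%:R * x ^+ 2 + 5%:R * t * x + 2%:R * t ^+ 2)))
   (256%:R * (t * (1 - 2%:R * t) * (4%:R + 5%:R * t + 2%:R * t ^+ 2))).
  apply: (agree_subM (T := 256%:R * t * (4%:R * (x ^+ 2 + x + 1) - 3%:R * t * (x + 1) - 8%:R * t ^+ 2)) base).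
  by rewrite -/x; ring.
apply: agree_trans (agree_sym step1) _.
apply/agree_sym; apply: (agree_subM (T := 256%:R * beta ^+ 4 *
   (4%:R * 'X ^+ 2 * r ^+ 3 - 4%:R * 'X ^+ 5 * r ^+ 11 - 4%:R * 'X ^+ 10 * r ^+ 8)) eps0).
transitivity (256%:R * beta ^+ 4 * (('X * y0) ^+ 2 - N * (b - 2%:R * N) *
     (4%:R * b ^+ 2 + 5%:R * N * b + 2%:R * N ^+ 2))).
  by rewrite /x /t; ring.
by rewrite klein_curve -/eps; ring.
Qed.

(** On the one hand the coefficient of degree 2p - 1 of G(u)^n u' is the Hasse
    invariant of the quartic, by [coef_comp_deriv].  On the other hand
    G(u) = v^2 and u' dz = v w dz up to constants, so G(u)^n u' = v^p w; as v^p
    is a series in z^p that starts in degree p, that coefficient is the one of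
    degree p - 1 in w. *)
Lemma hasse_klein_form : (quartic F ^+ n)`_(n.*2) = w`_(n.*2).
Proof.
have size_quartic : (size (quartic F ^+ n)%R <= (p.-1).*2.+1)%N.
  have size4 : (size (quartic F) <= 5)%N.
    have sizeXc k (c : F) : size ('X^(k.+1) + c%:P) = k.+2.
      by rewrite size_polyDl size_polyXn // size_polyC; case: eqP.
    apply: leq_trans (size_polyMleq _ _) _; rewrite sizeXc.
    suff : (size (1 - 4%:R^-1 *: ('X + 12%:R%:P) ^+ 2 : {poly F})%R <= 3)%N by lia.
    apply: leq_trans (size_polyD _ _) _; rewrite size_poly1 size_polyN geq_max /=.
    apply: leq_trans (size_scale_leq _ _) _.
    by apply: leq_trans (size_poly_exp_leq _ _) _; rewrite -['X]expr1 sizeXc.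
  apply: leq_trans (size_poly_exp_leq _ _) _.
  have : ((size (quartic F)).-1 * n <= 4 * n)%N by rewrite leq_mul2r; apply/orP; right; lia.
  by lia.
have lhs := coef_comp_deriv p_prime charFp (- 10%:R) eta size_quartic.
have rhs : agree (2 * p) (((quartic F ^+ n) \Po u) * u^`())
   ((256%:R * ('X * y0 * beta ^+ 2) ^+ 2) ^+ n * ((- 8%:R)%:P * (beta ^+ 2 * ('X * y0 * w)))).
  apply: agreeM; first by rewrite rmorphXn; apply: agreeX.
  apply: agree_trans (_ : agree _ ((b * beta) * u^`()) _).
    move=> i lt_i; rewrite -[in LHS](mul1r u^`()).
    by apply: agreeM lt_i => //; apply/agree_sym.
  rewrite mulrAC deriv_u.
  apply: (agree_subM (T := (- 8%:R)%:P * beta ^+ 2) differential).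
  by ring.
have p_gt0 := prime_gt0 p_prime.
have lt_2p : ((2 * p).-1 < 2 * p)%N by lia.
have := rhs _ lt_2p; rewrite lhs => {lhs rhs}.
have r0 : r.[0] = 1 by rewrite /r horner_exp !hornerE expr0n subr0 expr1n.
have b0 : b.[0] = 1.
  by have [Q ->] := b_split; rewrite hornerD hornerM hornerX mul0r addr0 -[1]/(1%:P) hornerC.
have y00 : y0.[0] = 2%:R.
  have -> : y0 = 2%:R%:P * r ^+ 5 + 'X * (3%:R * r ^+ 3 + 3%:R * 'X * r ^+ 8 + 'X ^+ 2 * r ^+ 6
      - 2%:R * 'X ^+ 3 * r ^+ 4 - 2%:R * 'X ^+ 4 * r ^+ 9 - 3%:R * 'X ^+ 5 * r ^+ 7).
    by rewrite polyC_natr /y0 /klein_y; ring.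
  by rewrite hornerD hornerCM [X in _ + X]hornerM hornerX mul0r addr0 [X in _ * X]horner_exp r0 expr1n mulr1.
have beta0 : beta.[0] = 1 by rewrite horner_exp b0 expr1n.
have [Q yQ] : exists Q, y0 * beta ^+ 2 = 2%:R%:P + 'X * Q.
  have /factor_theorem[Q eqQ] : root (y0 * beta ^+ 2 - 2%:R%:P) 0.
    by apply/eqP; rewrite hornerD hornerN hornerC hornerM horner_exp y00 beta0; ring.
  by exists Q; rewrite -[LHS](subrK 2%:R%:P) eqQ subr0 mulrC addrC.
have -> : (256%:R * ('X * y0 * beta ^+ 2) ^+ 2) ^+ n *
     ((- 8%:R)%:P * (beta ^+ 2 * ('X * y0 * w))) =
   'X^p * ((256%:R ^+ n * - 8%:R)%:P * (((2%:R ^+ p)%:P + 'X^p * Q ^+ p) * w)).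
  have -> : (2%:R ^+ p)%:P + 'X^p * Q ^+ p = (y0 * beta ^+ 2) ^+ p.
    by rewrite yQ (exprD_pchar _ _ charPp) exprMn rmorphXn.
  have -> : 'X^p * ((256%:R ^+ n * - 8%:R)%:P * ((y0 * beta ^+ 2) ^+ p * w)) =
      (256%:R ^+ n * - 8%:R)%:P * (('X * (y0 * beta ^+ 2)) ^+ p * w).
    by rewrite [('X * (y0 * _)) ^+ p]exprMn; ring.
  rewrite exprMn -exprM mul2n [in RHS]def_p [_ ^+ n.*2.+1]exprS polyCM rmorphXn /= polyC_natr.
  by rewrite -['X * y0 * beta ^+ 2]mulrA; move: (_ ^+ n.*2) => B; ring.
have p_pred : p.-1 = n.*2 by rewrite def_p.
have coef_top (V : {poly F}) c d :
    ('X^p * (c%:P * ((d%:P + 'X^p * Q ^+ p) * V)))`_(2 * p).-1 = c * (d * V`_p.-1).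
  rewrite coefXnM ltnNge (_ : p <= (2 * p).-1)%N /=; last by lia.
  have -> : ((2 * p).-1 - p = p.-1)%N by lia.
  rewrite coefCM mulrDl coefD coefCM -mulrA coefXnM (_ : p.-1 < p)%N; last by lia.
  by rewrite addr0.
rewrite coef_top p_pred.
have -> : eta`_0 = - 8%:R.
  by rewrite -horner_coef0 hornerCM hornerM beta0 horner_exp r0 expr1n !mulr1.
have natp := natr_exp_pchar charFp.
have -> : (- 8%:R) ^+ p = - 8%:R :> F.
  by rewrite exprNn natp -signr_odd def_p /= odd_double expr1 mulN1r.
rewrite natp.
have n16 : 16%:R != 0 :> F by rewrite (natrX _ 2 4) expf_neq0.
(* 256^n = 16^(p-1) *)
have -> : 256%:R ^+ n = 1 :> F.
  apply: (mulfI n16); rewrite mulr1 (natrX _ 16 2) -exprM mul2n -exprS -def_p.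
  exact: natp.
rewrite mul1r => eqH; apply: (mulfI n16); apply: oppr_inj.
transitivity ((quartic F ^+ n)`_n.*2 * (2%:R * - 8%:R)); first by ring.
by rewrite eqH; ring.
Qed.
End Hasse.

(** * The Hasse invariant as a binomial coefficient *)

(** Meant for p = 7f + c. *)
Definition binomial_residue (f c : nat) : int :=
  if c == 1 then 'C(3 * f, f)%:Z else
  if c == 2 then - 'C(3 * f, f)%:Z else
  if c == 4 then 'C((3 * f).+1, f)%:Z else 0.

Lemma binomial_residueE (R : nzRingType) (f c : nat) :
  (binomial_residue f c)%:~R =
    if c == 1 then 'C(3 * f, f)%:R else
    if c == 2 then - 'C(3 * f, f)%:R else
    if c == 4 then 'C((3 * f).+1, f)%:R else 0 :> R.
Proof.
rewrite /binomial_residue.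
by do 3?[case: ifP => _]; rewrite ?rmorphN /= -?pmulrn.
Qed.

Section HasseValue.
Variables (F : fieldType) (p f c : nat).
Hypotheses (p_prime : prime p) (charFp : p \in [pchar F]).
Hypotheses (p_odd : odd p) (def_p : p = (7 * f + c)%N).

Lemma coef_klein_form m k :
  (klein_form 'X ((1 - 'X^7) ^+ m) : {poly F})`_k =
    (if (7 %| k)%N then (-1) ^+ (k %/ 7) * 'C(m * 5, k %/ 7)%:R else 0)
    - (if (0 < k)%N && (7 %| k.-1)%N then (-1) ^+ (k.-1 %/ 7) * 'C(m * 3, k.-1 %/ 7)%:R else 0)
    + (if (2 < k)%N && (7 %| k - 3)%N then (-1) ^+ ((k - 3) %/ 7) * 'C(m * 6, (k - 3) %/ 7)%:R else 0).
Proof.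
have powE e i : (((1 - 'X^7) ^+ m) ^+ e : {poly F})`_i =
    if (7 %| i)%N then (-1) ^+ (i %/ 7) * 'C(m * e, i %/ 7)%:R else 0.
  rewrite -exprM.
  have -> : 1 - 'X^7 = 1%:P + (-1) *: 'X^7 :> {poly F} by rewrite scaleN1r.
  by rewrite coef_binomial expr1n mulr1 mulrC.
rewrite /klein_form coefD coefB coefXM coefXnM !powE ltnNge.
by case: k => [|[|[|k]]].
Qed.

Let charP k : (p %| k)%N -> k%:R = 0 :> F.
Proof. by move=> p_k; apply/eqP; rewrite (natr_eq0_pchar charFp). Qed.

Hypothesis c_unit : (0 < c < 7)%N.

Lemma exists_param : exists m, (7 * m).+1%:R = 0 :> F.
Proof.
suff [k [m def_m]] : exists k, exists m, (7 * m).+1 = (k * p)%N.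
  by exists m; rewrite def_m charP // dvdn_mull.
have : [|| c == 1, c == 2, c == 3, c == 4, c == 5 | c == 6]%N by lia.
case/or3P => [/eqP c1|/eqP c2|/or4P[]/eqP c3].
- by exists 1, f; lia.
- by exists 4, (4 * f + 1)%N; lia.
- by exists 5, (5 * f + 2)%N; lia.
- by exists 2, (2 * f + 1)%N; lia.
- by exists 3, (3 * f + 2)%N; lia.
- by exists 6, (6 * f + 5)%N; lia.
Qed.

(** The three terms of the differential have degrees 0, 1 and 3 modulo 7, and
    p - 1 = c - 1 modulo 7.  The coefficients are binomials of -e/7 over f for
    e = 5, 3, 6; [bin_reflect] rewrites them with the natural number 3f or
    3f + 1 on top. *)
Lemma hasse_value : (quartic F ^+ p./2)`_(p.-1) = (binomial_residue f c)%:~R.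
Proof.
have def_n : p = (p./2).*2.+1 by rewrite -[LHS]odd_double_half p_odd.
have [m m7] := exists_param.
have := hasse_klein_form p_prime charFp def_n m7.
have -> : (p./2).*2 = p.-1 by lia.
move=> ->; rewrite coef_klein_form binomial_residueE.
have p7_neq0 : 7%:R != 0 :> F.
  by rewrite (natr_eq0_pchar charFp) dvdn_prime2 //; apply/eqP; lia.
have reflect e b : (7 * b.+1 = 7 * f + e + 2 * p)%N ->
    (-1) ^+ f * 'C(m * e, f)%:R = 'C(b, f)%:R :> F.
  move=> def_b; have eq_f : (m * e + b).+1%:R = f%:R :> F.
    apply: (mulfI p7_neq0); apply: (addIr e%:R); rewrite -!natrM -!natrD.
    have -> : (7 * (m * e + b).+1 + e = e * (7 * m).+1 + (7 * f + e + 2 * p))%N by nia.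
    by rewrite natrD natrM m7 mulr0 add0r natrD natrM (charP (dvdnn p)) mulr0 addr0.
  rewrite (bin_reflect charFp _ eq_f); last by lia.
  by rewrite mulrA -expr2 sqrr_sign mul1r.
have def_p1 : p.-1 = (7 * f + c.-1)%N by lia.
have p_gt1 := prime_gt1 p_prime.
have test0 : (7 %| p.-1)%N = (c == 1)%N by lia.
have test1 : ((0 < p.-1) && (7 %| p.-1.-1))%N = (c == 2)%N by lia.
have test3 : ((2 < p.-1) && (7 %| p.-1 - 3))%N = (c == 4)%N by lia.
rewrite test0 test1 test3.
have [c1 | _] := eqVneq c 1.
  have -> : (p.-1 %/ 7 = f)%N by lia.
  by rewrite c1 /= subr0 addr0 (reflect _ (3 * f)%N) //; lia.
have [c2 | _] := eqVneq c 2.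
  have -> : (p.-1.-1 %/ 7 = f)%N by lia.
  by rewrite c2 /= sub0r addr0 (reflect _ (3 * f)%N) //; lia.
have [c4 | _] := eqVneq c 4; last by rewrite subr0 addr0.
have -> : ((p.-1 - 3) %/ 7 = f)%N by lia.
by rewrite subr0 add0r (reflect _ (3 * f).+1) //; lia.
Qed.
End HasseValue.

(** * Sums of seventh roots of unity in the quadratic subfield *)

(** p divides (u y - x w) (u y + x w), and by the composition identity for the
    form each factor is too small to be a nonzero multiple of p. *)
Lemma form7_unique (p : nat) (u w x y : int) : prime p ->
  p%:Z = u ^+ 2 + 7 * w ^+ 2 -> p%:Z = x ^+ 2 + 7 * y ^+ 2 ->
  u = x \/ u = - x.
Proof.
move=> p_prime puw pxy; have p_gt0 : 0 < p%:Z by rewrite ltz_nat prime_gt0.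
have sq : u ^+ 2 * y ^+ 2 = x ^+ 2 * w ^+ 2 -> u = x \/ u = - x.
  move=> eq_uy; suff /eqP : u ^+ 2 = x ^+ 2.
    by rewrite eqf_sqr => /orP[]/eqP; [left | right].
  apply: (mulIf (lt0r_neq0 p_gt0)); rewrite {1}pxy puw.
  transitivity (u ^+ 2 * x ^+ 2 + 7 * (u ^+ 2 * y ^+ 2)); first by ring.
  by rewrite eq_uy; ring.
have prod : (p%:Z %| (u * y - x * w) * (u * y + x * w))%Z.
  apply/dvdzP; exists (y ^+ 2 - w ^+ 2).
  transitivity ((u ^+ 2 + 7 * w ^+ 2) * y ^+ 2 - (x ^+ 2 + 7 * y ^+ 2) * w ^+ 2); first by ring.
  by rewrite -puw -pxy; ring.
have small e : (e = 1 \/ e = -1) -> (p%:Z %| u * y + e * x * w)%Z -> u * y + e * x * w = 0.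
  move=> e1 /dvdzP[q def_q].
  have norm : (u * x - 7 * e * w * y) ^+ 2 + 7 * (u * y + e * x * w) ^+ 2 = p%:Z ^+ 2.
    transitivity ((u ^+ 2 + 7 * w ^+ 2) * (x ^+ 2 + 7 * y ^+ 2)); last by rewrite -puw -pxy.
    by case: e1 => ->; ring.
  have [q0 | q_neq0] := eqVneq q 0; first by rewrite def_q q0 mul0r.
  have : 7 * p%:Z ^+ 2 <= p%:Z ^+ 2.
    rewrite -[leRHS]norm def_q.
    have q2_ge1 : 1 <= q ^+ 2 by rewrite -gtz0_ge1 exprn_even_gt0.
    rewrite exprMn -[leLHS]add0r lerD ?sqr_ge0 // ler_pM2l //.
    by rewrite ler_peMl ?sqr_ge0.
  by rewrite -[leRHS]mul1r ler_pM2r // exprn_gt0.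
move: prod; rewrite dvdzE abszM Euclid_dvdM // => /orP[] dvd.
  have := small (-1) (or_intror erefl); rewrite mulN1r mulNr dvdzE => /(_ dvd) eq0.
  by apply: sq; rewrite -!exprMn; congr (_ ^+ 2); apply/eqP; rewrite -subr_eq0 eq0.
have := small 1 (or_introl erefl); rewrite mul1r dvdzE => /(_ dvd) eq0.
by apply: sq; rewrite -!exprMn -[RHS]sqrrN; congr (_ ^+ 2); apply/eqP; rewrite -addr_eq0 eq0.
Qed.

Lemma prim_root_neq0 (F : fieldType) (n : nat) (z : F) :
  n.-primitive_root z -> z != 0.
Proof.
move=> prim_z; apply/eqP => z0; have /eqP := prim_expr_order prim_z.
by rewrite z0 expr0n eqn0Ngt (prim_order_gt0 prim_z) eq_sym oner_eq0.
Qed.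

(** This takes the place of complex characters: for integers c(v) indexed by the
    7th roots of unity and constant on v <> 1, the element sum c(v) v of the
    cyclotomic ring is the integer c(1) - c(theta). *)
Definition theta_test (F : fieldType) (theta v : F) : int :=
  (v == 1)%:Z - (v == theta)%:Z.

Lemma theta_test1 (F : fieldType) (theta : F) :
  7.-primitive_root theta -> theta_test theta 1 = 1.
Proof.
move=> theta7; rewrite /theta_test eqxx.
by have := eq_prim_root_expr theta7 0 1; rewrite expr0 expr1 => ->.
Qed.

Section SepticPeriods.
Variables (F : fieldType) (p : nat) (T : finType) (L : {set T}).
Variables (h : T -> F) (theta : F) (sigma : T -> T) (k : nat).
Hypotheses (p_odd : odd p) (charFp : p \in [pchar F]).
Hypothesis theta7 : 7.-primitive_root theta.
Hypothesis h7 : {in L, forall i, h i ^+ 7 = 1}.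
Hypotheses (k24 : k = 2 \/ k = 4) (sigmaL : {in L, forall i, sigma i \in L}).
Hypotheses (sigma_inj : {in L &, injective sigma}).
Hypothesis (h_sigma : {in L, forall i, h (sigma i) = h i ^+ k}).
Hypothesis correlation :
  \sum_(i in L) \sum_(j in L) theta_test theta (h i / h j) = p%:Z.

Let n (e : nat) : nat := #|[set i in L | h i == theta ^+ e]|.

Let theta_neq0 : theta != 0. Proof. exact: prim_root_neq0 theta7. Qed.

Let sum_fibers (V : zmodType) (f : F -> V) :
  \sum_(i in L) f (h i) = \sum_(e < 7) f (theta ^+ e) *+ n e.
Proof.
have fiber i : i \in L -> f (h i) = \sum_(e < 7) f (theta ^+ e) *+ (h i == theta ^+ e).
  move=> Li; have [e def_e] := prim_rootP theta7 (h7 Li).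
  rewrite (bigD1 e) //= -def_e eqxx big1 ?addr0 // => e' ne_e.
  rewrite def_e (eq_prim_root_expr theta7) !modn_small ?ltn_ord //.
  by case: eqP => // /val_inj eq_e; rewrite eq_e eqxx in ne_e.
rewrite (eq_bigr _ fiber) exchange_big /=; apply: eq_bigr => e _.
rewrite -sumr_const /= [RHS](eq_bigl (fun i => (i \in L) && (h i == theta ^+ e))) => [|i].
  by rewrite big_mkcondr; apply: eq_bigr => i _; case: eqP.
by rewrite inE.
Qed.

Let n_sigma e : (n e <= n (e * k %% 7))%N.
Proof.
rewrite -[n e](card_in_imset (f := sigma)) /=; last first.
  by move=> i j; rewrite !inE => /andP[Li _] /andP[Lj _]; apply: sigma_inj.
apply/subset_leq_card/subsetP => _ /imsetP[i /[!inE]/andP[Li /eqP def_i] ->].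
by rewrite sigmaL //= h_sigma // def_i -exprM (prim_expr_mod theta7).
Qed.

(** With n(e) the number of i such that h i = theta^e, consider the element
    R = sum n(e) zeta^e of the ring of 7th roots of unity.  The symmetry sigma
    makes n constant on the squares and on the nonsquares modulo 7, with values
    B and C; so R = n(0) + B eta + C eta' with eta, eta' the two quadratic
    periods, and R = u + w sqrt(-7) once B - C is known to be even.  The
    correlation hypothesis says that R times its conjugate is p.  In the field F
    of characteristic p that product vanishes, so one of the two conjugates is 0
    and the other one is their sum 2u. *)
Lemma septic_periods :
  exists u w : int, [/\ p%:Z = u ^+ 2 + 7 * w ^+ 2,
    exists v : int, u = #|L|%:Z + 7 * v &
    \sum_(i in L) (h i)^-1 = 0 \/ \sum_(i in L) (h i)^-1 = (2 * u)%:~R].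
Proof.
have n7 : [/\ n 2 = n 1, n 4 = n 1, n 5 = n 3 & n 6 = n 3].
  case: k24 => def_k; move: n_sigma; rewrite def_k => mono.
    have [n12 n24 n41] : [/\ n 1 <= n 2, n 2 <= n 4 & n 4 <= n 1]%N.
      by split; [exact: (mono 1) | exact: (mono 2) | exact: (mono 4)].
    have [n36 n65 n53] : [/\ n 3 <= n 6, n 6 <= n 5 & n 5 <= n 3]%N.
      by split; [exact: (mono 3) | exact: (mono 6) | exact: (mono 5)].
    by split; lia.
  have [n14 n42 n21] : [/\ n 1 <= n 4, n 4 <= n 2 & n 2 <= n 1]%N.
    by split; [exact: (mono 1) | exact: (mono 4) | exact: (mono 2)].
  have [n35 n56 n63] : [/\ n 3 <= n 5, n 5 <= n 6 & n 6 <= n 3]%N.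
    by split; [exact: (mono 3) | exact: (mono 5) | exact: (mono 6)].
  by split; lia.
have [n2 n4 n5 n6] := n7.
pose N0 := (n 0)%:Z; pose B := (n 1)%:Z; pose C := (n 3)%:Z.
have sum7 (V : zmodType) (f : nat -> V) :
    \sum_(e < 7) f e = f 0%N + f 1%N + f 2%N + f 3%N + f 4%N + f 5%N + f 6%N.
  by rewrite !big_ord_recr big_ord0 /= add0r.
have cardL : #|L|%:Z = N0 + 3 * B + 3 * C.
  rewrite -[#|L|%:Z]natz -sumr_const (sum_fibers (fun=> 1)).
  by rewrite (sum7 _ (fun e => 1 *+ n e)) n2 n4 n5 n6 /N0 /B /C !natz; lia.
have corr : p%:Z = N0 ^+ 2 + 2 * B ^+ 2 + 2 * C ^+ 2 - N0 * (B + C) - 3 * B * C.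
  rewrite -correlation.
  pose delta (e e' : nat) : int := (e == e')%:Z - (e == (e'.+1 %% 7)%N)%:Z.
  have testE e e' : (e < 7)%N -> (e' < 7)%N ->
      theta_test theta (theta ^+ e / theta ^+ e') = delta e e'.
    move=> lt_e lt_e'.
    have nz : theta ^+ e' != 0 by rewrite expf_neq0 ?theta_neq0.
    have test1 : (theta ^+ e / theta ^+ e' == 1) = (e == e').
      rewrite -(divff nz) (inj_eq (mulIf (invr_neq0 nz))).
      by rewrite (eq_prim_root_expr theta7) !modn_small.
    have test2 : (theta ^+ e / theta ^+ e' == theta) = (e == e'.+1 %% 7)%N.
      rewrite -[X in _ == X](mulfK nz) -exprS (inj_eq (mulIf (invr_neq0 nz))).
      by rewrite (eq_prim_root_expr theta7) (modn_small lt_e).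
    by rewrite /theta_test test1 test2.
  transitivity (\sum_(e < 7) (\sum_(e' < 7) delta e e' *+ n e') *+ n e).
    rewrite (sum_fibers (fun x => \sum_(j in L) theta_test theta (x / h j))).
    apply: eq_bigr => e _; congr (_ *+ _).
    rewrite (sum_fibers (fun y => theta_test theta (theta ^+ e / y))).
    by apply: eq_bigr => e' _; rewrite testE.
  rewrite (sum7 _ (fun e => (\sum_(e' < 7) delta e e' *+ n e') *+ n e)).
  rewrite !(sum7 _ (fun e' => delta _ e' *+ n e')).
  have mulzn (x : int) e : x *+ n e = x * (n e)%:Z by rewrite -mulr_natr natz.
  rewrite !mulzn n2 n4 n5 n6 -/N0 -/B -/C /delta /=.
  by ring.
(* If B - C were odd, the norm form would make p even. *)
have [w def_B] : exists w, B = C + 2 * w.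
  pose e := N0 - B.
  have corr2 : p%:Z = 2 * (B - C) ^+ 2 + e * (e + (B - C)).
    by rewrite corr /e; ring.
  have halve (z : int) : exists q, z = 2 * q \/ z = 2 * q + 1.
    by exists (z %/ 2)%Z; lia.
  have not_even (z : int) : p%:Z = 2 * z -> False.
    move=> eq_z; have def_p : p = `|z|%N.*2 by clear -eq_z; lia.
    by move: p_odd; rewrite def_p odd_double.
  have [w [def_w | def_w]] := halve (B - C); first by exists w; rewrite -def_w addrC subrK.
  rewrite def_w in corr2; have [q [def_e | def_e]] := halve e.
    case: (not_even ((2 * w + 1) ^+ 2 + q * (2 * q + 2 * w + 1))).
    by rewrite corr2 def_e; ring.
  case: (not_even ((2 * w + 1) ^+ 2 + (2 * q + 1) * (q + w + 1))).
  by rewrite corr2 def_e; ring.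
pose u := N0 - C - w; exists u, w; split.
- by rewrite corr def_B /u; ring.
- by exists (- C - w); rewrite cardL def_B /u; ring.
have p0 : p%:R = 0 :> F by rewrite (pcharf0 charFp).
pose eta := theta + theta ^+ 2 + theta ^+ 4.
pose eta' := theta ^+ 3 + theta ^+ 5 + theta ^+ 6.
have th7 := prim_expr_order theta7.
have eta_sum : eta + eta' = -1.
  have : (theta - 1) * (1 + eta + eta') = 0.
    by transitivity (theta ^+ 7 - 1); [rewrite /eta /eta'; ring | rewrite th7 subrr].
  move/eqP; rewrite mulf_eq0 => /orP[/eqP th1|].
    have := eq_prim_root_expr theta7 1 0; rewrite expr1 expr0.
    by move/eqP: th1; rewrite subr_eq0 => ->.
  by rewrite -addrA addrC addr_eq0 => /eqP.
have eta_prod : eta * eta' = 2%:R.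
  have -> : eta * eta' = 3%:R + (eta + eta') + (theta ^+ 7 - 1) * (3%:R + theta + theta ^+ 2 + theta ^+ 3).
    by rewrite /eta /eta'; ring.
  by rewrite th7 subrr mul0r eta_sum; ring.
have conj_sum : \sum_(i in L) (h i)^-1 = N0%:~R + B%:~R * eta' + C%:~R * eta.
  have inv_theta e e' : (e + e' = 7)%N -> (theta ^+ e)^-1 = theta ^+ e'.
    move=> sum_e; apply: (mulfI (expf_neq0 e theta_neq0)).
    by rewrite mulfV ?expf_neq0 ?theta_neq0 // -exprD sum_e th7.
  rewrite (sum_fibers (fun x => x^-1)) (sum7 _ (fun e => (theta ^+ e)^-1 *+ n e)).
  rewrite (inv_theta 1%N 6) // (inv_theta 2%N 5) // (inv_theta 3%N 4) //.
  rewrite (inv_theta 4%N 3) // (inv_theta 5%N 2) // (inv_theta 6%N 1%N) //.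
  have mulrn (x : F) e : x *+ n e = x * (n e)%:Z%:~R by rewrite -mulr_natr pmulrn.
  rewrite expr0 invr1 !mulrn n2 n4 n5 n6 -/N0 -/B -/C /eta /eta'.
  by move: (N0) (B) (C) => a b c; ring.
have norm0 : (N0%:~R + B%:~R * eta' + C%:~R * eta) * (N0%:~R + B%:~R * eta + C%:~R * eta') = 0.
  transitivity (p%:Z%:~R : F); last by rewrite -pmulrn.
  rewrite corr; move: (N0) (B) (C) => a b c.
  transitivity (a%:~R ^+ 2 + a%:~R * (b%:~R + c%:~R) * (eta + eta') + (b%:~R ^+ 2 + c%:~R ^+ 2) * (eta * eta')
     + b%:~R * c%:~R * ((eta + eta') ^+ 2 - 2%:R * (eta * eta'))); first by ring.
  by rewrite eta_sum eta_prod; ring.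
have trace : (N0%:~R + B%:~R * eta' + C%:~R * eta) + (N0%:~R + B%:~R * eta + C%:~R * eta') = (2 * u)%:~R.
  transitivity (2%:R * N0%:~R + (B%:~R + C%:~R) * (eta + eta')); first by ring.
  by rewrite eta_sum /u def_B; ring.
rewrite conj_sum; move/eqP: norm0; rewrite mulf_eq0 => /orP[/eqP-> | /eqP conj0]; first by left.
by right; rewrite -trace conj0 addr0.
Qed.
End SepticPeriods.

(** * Primes congruent to 1 modulo 7 *)

Section FiniteField.
Variable F : finFieldType.

Lemma finField_prim_root : exists g : F, (#|F|.-1).-primitive_root g.
Proof.
have F_gt1 := finNzRing_gt1 F.
have unity (x : F) : x != 0 -> x ^+ #|F|.-1 = 1.
  move=> x_neq0; apply: (mulfI x_neq0); rewrite -exprS prednK ?expf_card ?mulr1 //.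
  exact: ltnW.
have : has (#|F|.-1).-primitive_root (enum (predC1 (0 : F))).
  apply: has_prim_root; first by rewrite -ltnS prednK // ltnW.
  - by apply/allP=> x; rewrite mem_enum => /unity x1; apply/unity_rootP.
  - exact: enum_uniq.
  - by rewrite -cardE cardC1.
by case/hasP => g _ prim_g; exists g.
Qed.

(** Multiplication by c exchanges the two values that are counted with opposite
    signs. *)
Lemma sum_theta_test0 (P : pred F) (h : F -> F) (c theta : F) :
  c != 0 -> theta != 0 -> (forall a, P (c * a) = P a) ->
  (forall a, P a -> h (c * a) = theta * h a) ->
  \sum_(a | P a) theta_test theta (h a) = 0 :> int.
Proof.
move=> c_neq0 th_neq0 Pc hc; rewrite sumrB.
rewrite [X in _ - X](reindex_inj (mulfI c_neq0)) /= [X in _ - X](eq_bigl P) //.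
apply/eqP; rewrite subr_eq0; apply/eqP/eq_bigr => a Pa; rewrite hc //.
by rewrite -{2}[theta](mulr1 theta) (inj_eq (mulfI th_neq0)).
Qed.

Lemma sum_exp_subgroup (P : pred F) (c : F) (k : nat) :
  c != 0 -> (forall a, P (c * a) = P a) -> c ^+ k != 1 ->
  \sum_(a | P a) a ^+ k = 0.
Proof.
move=> c_neq0 Pc ck_neq1.
have eqS : \sum_(a | P a) a ^+ k = c ^+ k * \sum_(a | P a) a ^+ k.
  rewrite {1}(reindex_inj (mulfI c_neq0)) /= (eq_bigl P) // mulr_sumr.
  by apply: eq_bigr => a _; rewrite exprMn.
apply/eqP; move/eqP: eqS; rewrite -subr_eq0 -{1}[\sum_(a | P a) _]mul1r -mulrBl mulf_eq0.
by rewrite subr_eq0 eq_sym (negPf ck_neq1).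
Qed.
End FiniteField.

Section SplitCase.
Variables (F : finFieldType) (p f : nat).
Hypotheses (p_odd : odd p) (charFp : p \in [pchar F]) (cardF : #|F| = p).
Hypothesis def_p : p = (7 * f + 1)%N.

Let p_prime : prime p. Proof. exact: pcharf_prime charFp. Qed.
Let f_gt0 : (0 < f)%N. Proof. by have := prime_gt1 p_prime; lia. Qed.

Let unity (x : F) : x != 0 -> x ^+ (7 * f) = 1.
Proof.
move=> x_neq0; apply: (mulfI x_neq0); rewrite -exprS mulr1.
by rewrite -[RHS]expf_card cardF def_p addn1.
Qed.

Let sign_f : (-1) ^+ f = 1 :> F.
Proof. by rewrite -signr_odd; have -> : odd f = false by lia. Qed.

(* L is the line x + y + 1 = 0 without its points on the coordinate axes, in
   projective coordinates (x : y : 1); h is the value of the form x y^4 z^2 of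
   degree 7, to the power (p - 1) / 7; sigma permutes the coordinates
   cyclically, which turns x y^4 z^2 into its square up to 7th powers. *)
Let L : {set F} := [set x | (x != 0) && (1 + x != 0)].
Let h (x : F) : F := (x * (1 + x) ^+ 4) ^+ f.
Let sigma (x : F) : F := - (1 + x) / x.

(** Expanding x^(6f) (1 + x)^(3f), only the term of degree p - 1 = 7f has a
    nonzero sum over the field. *)
Lemma split_sum_inv : \sum_(x in L) (h x)^-1 = - 'C(3 * f, f)%:R.
Proof.
have [g prim_g] := finField_prim_root F.
transitivity (\sum_(x : F) x ^+ (6 * f) * (1 + x) ^+ (3 * f)).
  rewrite [RHS](bigID (mem L)) /= [X in _ + X]big1 ?addr0 => [|x].
    apply: eq_bigr => x; rewrite inE => /andP[x_neq0 y_neq0].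
    have hx : h x = x ^+ f * (1 + x) ^+ (4 * f) by rewrite /h exprMn -exprM.
    have hx_neq0 : h x != 0 by rewrite hx mulf_neq0 ?expf_neq0.
    apply: (mulfI hx_neq0); rewrite divff // hx mulrACA -!exprD.
    by rewrite -mulSn -mulnDl !unity ?mulr1.
  rewrite inE negb_and !negbK => /orP[] /eqP ->; rewrite expr0n.
    by rewrite muln_eq0 (gtn_eqF f_gt0) mul0r.
  by rewrite muln_eq0 (gtn_eqF f_gt0) mulr0.
transitivity (\sum_(i < (3 * f).+1) 'C(3 * f, i)%:R * \sum_(x : F) x ^+ (6 * f + i)).
  under [RHS]eq_bigr => i _ do rewrite mulr_sumr.
  rewrite exchange_big /=; apply: eq_bigr => x _.
  rewrite exprDn mulr_sumr; apply: eq_bigr => i _.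
  by rewrite expr1n mul1r mulrnAr exprD -mulr_natl.
have lt_f : (f < (3 * f).+1)%N by lia.
rewrite (bigD1 (Ordinal lt_f)) //= [X in _ + X]big1 ?addr0 => [|i ne_if].
  have -> : (6 * f + f = 7 * f)%N by lia.
  rewrite (bigD1 0) //= expr0n muln_eq0 (gtn_eqF f_gt0) add0r.
  rewrite (eq_bigr (fun=> 1)) => [|x x_neq0]; last by rewrite unity.
  rewrite sumr_const cardC1 cardF -mulrN1; congr (_ * _); apply/eqP.
  by rewrite -addr_eq0 natr1 prednK ?prime_gt0 // (natr_eq0_pchar charFp).
rewrite (sum_exp_subgroup (c := g)) ?mulr0 ?(prim_root_neq0 prim_g) //.
rewrite -(expr0 g) (eq_prim_root_expr prim_g) cardF def_p addn1 /= mod0n.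
move: ne_if; rewrite -val_eqE /= => ne_if; have lt_i := ltn_ord i.
have [lt_7 | ge_7] := ltnP (6 * f + i) (7 * f).
  by rewrite modn_small //; lia.
rewrite -[(6 * f + i)%N](subnK ge_7) modnDr modn_small; lia.
Qed.

Variable g : F.
Hypothesis prim_g : (#|F|.-1).-primitive_root g.
Let theta := g ^+ f.
Let g_neq0 : g != 0. Proof. exact: prim_root_neq0 prim_g. Qed.

Let theta7 : 7.-primitive_root theta.
Proof.
have def_p1 : #|F|.-1 = (7 * f)%N by rewrite cardF def_p addn1.
have /(dvdn_prim_root prim_g) : (7 %| #|F|.-1)%N by rewrite def_p1 dvdn_mulr.
by rewrite def_p1 mulKn.
Qed.

Let test_sum k k' (w : F) : (k * k' = 1 %[mod 7])%N ->
  \sum_(a | a != 0) theta_test theta ((a ^+ k * w) ^+ f) = 0.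
Proof.
move=> kk'; apply: (sum_theta_test0 (c := g ^+ k')); first exact: expf_neq0.
- exact: expf_neq0.
- by move=> a; rewrite mulf_eq0 (negPf (expf_neq0 _ g_neq0)).
move=> a _; rewrite [(g ^+ k' * a) ^+ k]exprMn -mulrA [LHS]exprMn; congr (_ * _).
have /eqP : theta ^+ (k * k') == theta ^+ 1 by rewrite (eq_prim_root_expr theta7); apply/eqP.
by rewrite expr1 => <-; rewrite -!exprM mulnA mulnC [(k' * k)%N]mulnC.
Qed.

Let unit_test : theta_test theta 1 = 1. Proof. exact: theta_test1. Qed.

Lemma split_card : #|L| = (p - 2)%N.
Proof.
have -> : L = ~: [set 0; -1].
  by apply/setP=> x; rewrite !inE negb_or [1 + x]addrC addr_eq0.
by rewrite cardsCs setCK cards2 cardF eq_sym oppr_eq0 oner_eq0.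
Qed.

(** Two distinct points of the line have coordinate ratios a = x / x' and
    b = y / y' with a, b, 1 pairwise distinct, and every such pair (a, b)
    arises exactly once.  Over all pairs of nonzero elements the test function
    has sum 0, so that only the three excluded lines a = 1, b = 1, a = b
    contribute; they all contain (1, 1). *)
Lemma split_correlation :
  \sum_(x in L) \sum_(y in L) theta_test theta (h x / h y) = p%:Z.
Proof.
pose psi := theta_test theta.
rewrite pair_big /= (bigID (fun z => z.1 == z.2)) /=.
have -> : \sum_(z | ((z.1 \in L) && (z.2 \in L)) && (z.1 == z.2)) psi (h z.1 / h z.2) = (#|L|)%:Z.
  rewrite (reindex_onto (fun x => (x, x)) (fun z => z.1)) /=; last first.
    by move=> [x y] /= /andP[_ /eqP ->].
  rewrite (eq_bigl (fun x => x \in L)) => [|x]; last by rewrite !eqxx andbb !andbT.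
  rewrite (eq_bigr (fun=> 1)) ?sumr_const ?natz // => x.
  rewrite inE => /andP[x_neq0 y_neq0]; rewrite divff ?unit_test //.
  by rewrite expf_neq0 // mulf_neq0 ?expf_neq0.
pose good (z : F * F) := (z.1 != 0) && (z.1 != 1) && ((z.2 != 0) && (z.2 != 1) && (z.2 != z.1)).
have -> : \sum_(z | ((z.1 \in L) && (z.2 \in L)) && (z.1 != z.2)) psi (h z.1 / h z.2) =
    \sum_(z | good z) psi ((z.2 ^+ 1 * z.1 ^+ 4) ^+ f).
  (* For z = (b, a) the points (a y, b (1 + y)) and (y, 1 + y) are on the line. *)
  pose y (z : F * F) := (z.1 - 1) / (z.2 - z.1).
  rewrite (reindex_onto (fun z => (z.2 * y z, y z)) (fun z => ((1 + z.1) / (1 + z.2), z.1 / z.2))) /=.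
    have y_props z : good z -> [/\ z.2 != 0, y z != 0, 1 + y z != 0 & 1 + z.2 * y z = z.1 * (1 + y z)].
      case: z => b a; rewrite /good /y /= => /and3P[/andP[b0 b1] /andP[a0 a1] ab].
      have ab' : a - b != 0 by rewrite subr_eq0.
      have -> : 1 + (b - 1) / (a - b) = (a - 1) / (a - b) by field.
      by split; rewrite ?mulf_neq0 ?invr_eq0 ?subr_eq0 //; field.
    have iff z : (z.2 * y z \in L) && (y z \in L) && (z.2 * y z != y z) &&
        (((1 + z.2 * y z) / (1 + y z), z.2 * y z / y z) == z) = good z.
      apply/idP/idP.
        case: z => b a; rewrite !inE xpair_eqE /= => /andP[/andP[/andP[]]].
        move=> /andP[ay0 ay1] /andP[y0 y1] ayy /andP[/eqP def_b _].
        move: ay0; rewrite mulf_eq0 (negPf y0) orbF => a0.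
        have a1 : a != 1 by apply: contraNneq ayy => ->; rewrite mul1r.
        have b0 : b != 0 by rewrite -def_b mulf_neq0 ?invr_eq0.
        have ab : a != b by apply: contraNneq y0 => eq_ab; rewrite /y eq_ab /= subrr invr0 mulr0.
        have b1 : b != 1 by apply: contraNneq y0 => ->; rewrite /y /= subrr mul0r.
        by rewrite /good /= b0 b1 a0 a1 ab.
      move=> gz; have [a0 y0 y1 def_y] := y_props z gz.
      case: z gz a0 y0 y1 def_y => b a /= gz a0 y0 y1 def_y.
      have /and3P[/andP[b0 b1] /andP[_ a1] ab] := gz.
      rewrite !inE xpair_eqE; move: (y _) y0 y1 def_y => t t0 t1 def_t.
      rewrite def_t t0 t1 /= (mulfK t1) (mulfK t0) !eqxx !mulf_neq0 //= andbT.
      by rewrite -{2}[t]mul1r (inj_eq (mulIf t0)).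
    rewrite (eq_bigl _ _ iff); apply: eq_bigr => z gz; have [_ y0 y1 def_y] := y_props z gz.
    rewrite /h def_y -expr_div_n; congr (psi (_ ^+ f)).
    by move: (y z) y0 y1 => t t0 t1; field; rewrite t0 t1.
  case=> x x' /=; rewrite !inE => /andP[/andP[/andP[x0 x1] /andP[y0 y1]]] ne_x.
  suff -> : y ((1 + x) / (1 + x'), x / x') = x' by rewrite divfK.
  rewrite /y /=.
  have d0 : x - x' != 0 by rewrite subr_eq0.
  have -> : (1 + x) / (1 + x') - 1 = (x - x') / (1 + x') by field.
  have -> : x / x' - (1 + x) / (1 + x') = (x - x') / (x' * (1 + x')) by field; rewrite y1 y0.
  by field; rewrite ?d0 ?y0 ?y1.
rewrite split_card.
rewrite -(pair_big_dep (fun b => (b != 0) && (b != 1)) (fun b a => (a != 0) && (a != 1) && (a != b))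
  (fun b a => psi ((a ^+ 1 * b ^+ 4) ^+ f))) /=.
have lin (u v w : int) : u + (v + w) = 0 -> w = - u - v by lia.
have inner b : (b != 0) && (b != 1) ->
   \sum_(a | (a != 0) && (a != 1) && (a != b)) psi ((a ^+ 1 * b ^+ 4) ^+ f) =
   - psi ((b ^+ 4 * 1) ^+ f) - psi ((b ^+ 5 * 1) ^+ f).
  case/andP=> b_neq0 b_neq1.
  have := @test_sum 1 1 (b ^+ 4) erefl; rewrite (bigD1 1) ?oner_eq0 //= (bigD1 b) /=; last first.
    by rewrite b_neq0 b_neq1.
  rewrite expr1n mul1r -exprD !mulr1 -/psi => eq0.
  exact: lin.
have fin (a b : int) : (1 < p)%N -> 1 + b = 0 -> 1 + a = 0 -> (p - 2)%N%:Z + (- a - b) = p%:Z by lia.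
rewrite (eq_bigr _ inner) sumrB sumrN.
have psi1 : psi 1 = 1 := unit_test.
have := @test_sum 4 2 1 erefl; have := @test_sum 5 3 1 erefl.
rewrite ![\sum_(a | a != 0) _](bigD1 1) ?oner_eq0 //= !expr1n !mulr1 !expr1n -/psi psi1.
exact: fin (prime_gt1 p_prime).
Qed.

Lemma split_periods : exists u w : int,
  [/\ p%:Z = u ^+ 2 + 7 * w ^+ 2, exists v : int, u = 6 + 7 * v
    & 'C(3 * f, f)%:R = 0 :> F \/ 'C(3 * f, f)%:R = - (2 * u)%:~R :> F].
Proof.
have L_neq0 x : x \in L -> [/\ x != 0, 1 + x != 0 & x * (1 + x) ^+ 4 != 0].
  by rewrite inE => /andP[x0 y0]; split; rewrite ?mulf_neq0 ?expf_neq0.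
have sigma1 x : x != 0 -> 1 + sigma x = - x^-1 by move=> x0; rewrite /sigma; field.
have sigmaL x : x \in L -> sigma x \in L.
  move/L_neq0=> [x0 y0 _]; rewrite inE sigma1 // oppr_eq0 invr_eq0 x0 andbT.
  by rewrite mulf_neq0 ?oppr_eq0 ?invr_eq0.
have sigma_inj : {in L &, injective sigma}.
  move=> x x' /L_neq0[x0 _ _] /L_neq0[x'0 _ _] /(congr1 (fun t => 1 + t)).
  by rewrite !sigma1 // => /oppr_inj/invr_inj.
have h_sigma : {in L, forall x, h (sigma x) = h x ^+ 2}.
  move=> x /L_neq0[x0 y0 _]; rewrite /h sigma1 //.
  have -> : sigma x * (- x^-1) ^+ 4 = -1 * ((1 + x) * x ^+ 2) / x ^+ 7 by rewrite /sigma; field.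
  rewrite -exprM mulnC exprM.
  have -> : (x * (1 + x) ^+ 4) ^+ 2 = (1 + x) * x ^+ 2 * (1 + x) ^+ 7 by ring.
  by rewrite expr_div_n [in RHS]exprMn -!exprM !unity // divr1 mulr1 exprMn sign_f mul1r.
have h7 : {in L, forall x, h x ^+ 7 = 1}.
  by move=> x /L_neq0[_ _ hx]; rewrite /h -exprM mulnC unity.
have [u [w [puw [v def_u] sum_h]]] :=
  septic_periods p_odd charFp theta7 h7 (or_introl erefl) sigmaL sigma_inj h_sigma split_correlation.
exists u, w; split=> //.
  by exists (f%:Z + v - 1); rewrite def_u split_card; have := prime_gt1 p_prime; lia.
move: sum_h; rewrite split_sum_inv => -[/eqP | <-]; last by right; rewrite opprK.
by rewrite oppr_eq0 => /eqP; left.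
Qed.
End SplitCase.

(** * Primes congruent to 2 or 4 modulo 7 *)

Section SingerCase.
Variables (F : finFieldType) (p f c t0 : nat).
Hypotheses (p_odd : odd p) (charFp : p \in [pchar F]).
Hypotheses (def_p : p = (7 * f + c)%N) (c24 : c = 2 \/ c = 4).

(* The number t0 + p f is the quotient of p^2 + p + 1 by 7, less one, written in
   base p. *)
Let N := (p ^ 2 + p + 1)%N.
Let E := (N %/ 7)%N.
Hypothesis def_E : E = (t0 + p * f).+1.
Hypothesis t0_lt : (f <= t0 < p)%N.

Let p_prime : prime p. Proof. exact: pcharf_prime charFp. Qed.
Let p_gt1 : (1 < p)%N. Proof. exact: prime_gt1. Qed.
Let E7 : (E * 7 = N)%N.
Proof.
apply: divnK; apply/dvdnP; rewrite /N def_p.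
case: c24 => ->; [exists (7 * f ^ 2 + 5 * f + 1)%N | exists (7 * f ^ 2 + 9 * f + 3)%N]; ring.
Qed.

Variable gamma : F.
Hypothesis prim_gamma : N.-primitive_root gamma.
Let theta := gamma ^+ E.
Let gamma_neq0 : gamma != 0. Proof. exact: prim_root_neq0 prim_gamma. Qed.

Let frobD (x y : F) : (x + y) ^+ p = x ^+ p + y ^+ p.
Proof. exact: exprD_pchar. Qed.

Let frob_inj : injective (fun x : F => x ^+ p).
Proof. by move=> x y; rewrite -!(pFrobenius_autE charFp) => /fmorph_inj. Qed.

Let theta7 : 7.-primitive_root theta.
Proof.
have /(dvdn_prim_root prim_gamma) : (7 %| N)%N by rewrite -E7 dvdn_mull.
by [].
Qed.

Let s (w : F) := 1 + w + w ^+ p.+1.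
(* For w = x^(p-1) one has x * s w = x + x^p + x^(p^2), so that L is the plane of
   elements of trace 0 in the field of p^3 elements, seen projectively in the
   group of elements of norm 1. *)
Let L : {set F} := [set w | s w == 0].

Let L_neq0 w : w \in L -> w != 0.
Proof. by rewrite inE; apply: contraTneq => ->; rewrite /s expr0n !addr0 oner_eq0. Qed.

Let s_frob w : w ^+ N = 1 -> w * s w ^+ p = s w.
Proof.
move=> wN; rewrite /s !frobD expr1n -exprM !mulrDr mulr1 -!exprS.
have -> : w ^+ (p.+1 * p).+1 = 1 by rewrite -wN; congr (_ ^+ _); rewrite /N; lia.
by rewrite addrC addrA.
Qed.

Let L_unity w : w \in L -> w ^+ N = 1.
Proof.
rewrite inE => /eqP sw0; have : w * s w ^+ p = 0.
  by rewrite sw0 expr0n gtn_eqF ?mulr0 // ltnW.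
rewrite /s !frobD expr1n -exprM !mulrDr mulr1 -!exprS => eq0.
have -> : N = (p.+1 * p).+1 by rewrite /N; lia.
move: sw0; rewrite /s -addrA => /eqP; rewrite addrC addr_eq0 => /eqP eq1.
by rewrite eq1 in eq0; move/eqP: eq0; rewrite addrC subr_eq0 => /eqP.
Qed.

Let unity_frob (d : F) : d ^+ N = 1 -> d ^+ p = 1 -> d = 1.
Proof.
move=> dN dp; have := dN; rewrite /N !exprD expr1 dp expnS expn1 exprM dp expr1n !mul1r.
by [].
Qed.

(* Two distinct planes through the origin meet in a line: Y d is the point common
   to L and to its translate by the inverse of d. *)
Let Y (d : F) := (d ^+ p.+1 - 1) / (d - d ^+ p.+1).

Let Y_props d : d ^+ N = 1 -> d != 1 -> (Y d \in L) && (d * Y d \in L).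
Proof.
move=> dN d1.
have d0 : d != 0.
  by apply: contraTneq (oner_neq0 F) => d0; rewrite -dN d0 expr0n negbK /N addn1.
pose e := d ^+ p.
have e1 : e - 1 != 0 by rewrite subr_eq0; apply: contra d1 => /eqP/(unity_frob dN)->.
have eS : d ^+ p.+1 = d * e by rewrite exprS.
have ee : e ^+ p = (d * e)^-1.
  apply: (mulfI (mulf_neq0 d0 (expf_neq0 p d0))); rewrite -/e divff ?mulf_neq0 ?expf_neq0 //.
  by rewrite -dN /e -exprM -exprS -exprD /N addnC -addn1 addnA mulnn.
have de1 : d * e - 1 != 0.
  rewrite subr_eq0; apply: contra e1 => /eqP de1; rewrite subr_eq0; apply/eqP.
  by apply: frob_inj; rewrite ee de1 invr1 expr1n.
have e0 : e != 0 by rewrite expf_neq0.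
have Yp : Y d ^+ p = (1 - d) / (d * e - 1).
  have frobB (x y : F) : (x - y) ^+ p = x ^+ p - y ^+ p.
    by rewrite frobD exprNn -signr_odd p_odd expr1 mulN1r.
  rewrite /Y eS expr_div_n !frobB expr1n exprMn -/e ee.
  by field; rewrite de1 e0 d0.
have YS : Y d ^+ p.+1 = Y d * ((1 - d) / (d * e - 1)) by rewrite exprS Yp.
have den : d - d * e != 0.
  by rewrite -{1}[d]mulr1 -mulrBr mulf_neq0 // -opprB oppr_eq0.
rewrite !inE /s [(d * Y d) ^+ p.+1]exprMn YS eS /Y eS.
by apply/andP; split; apply/eqP; field; rewrite ?de1 ?den.
Qed.

Let Y_unique (d y : F) : d ^+ N = 1 -> d != 1 -> y \in L -> d * y \in L -> y = Y d.
Proof.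
move=> dN d1; rewrite !inE /s exprMn => /eqP sy /eqP sdy.
have den : d - d ^+ p.+1 != 0.
  rewrite exprS -{1}[d]mulr1 -mulrBr mulf_neq0 //.
    by apply: contraTneq (oner_neq0 F) => d0; rewrite -dN d0 expr0n negbK /N addn1.
  by rewrite subr_eq0 eq_sym; apply: contra d1 => /eqP/(unity_frob dN)->.
apply: (mulIf den); rewrite /Y divfK //; apply/eqP; rewrite -subr_eq0; apply/eqP.
transitivity ((1 + d * y + d ^+ p.+1 * y ^+ p.+1) - d ^+ p.+1 * (1 + y + y ^+ p.+1)); first by ring.
by rewrite sy sdy mulr0 subrr.
Qed.

(* Singer's theorem: every d <> 1 of norm 1 is exactly once the ratio of two
   elements of L. *)
Let pair_sum (V : zmodType) (phi : F -> V) :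
  \sum_(x in L) \sum_(y in L) phi (x / y) =
  phi 1 *+ #|L| + \sum_(d | (d ^+ N == 1) && (d != 1)) phi d.
Proof.
rewrite pair_big /= (bigID (fun z => z.1 == z.2)) /=; congr (_ + _).
  rewrite (reindex_onto (fun x => (x, x)) (fun z => z.1)) /=; last first.
    by move=> [x y] /= /andP[_ /eqP ->].
  rewrite (eq_bigl (fun x => x \in L)) => [|x]; last by rewrite !eqxx andbb !andbT.
  by rewrite -sumr_const; apply: eq_bigr => x /L_neq0 x0; rewrite divff.
have ratio z : (z.1 \in L) && (z.2 \in L) && (z.1 != z.2) ->
    [/\ (z.1 / z.2) ^+ N = 1, z.1 / z.2 != 1 & Y (z.1 / z.2) = z.2].
  case: z => x y /= /andP[/andP[Lx Ly] ne_xy]; have y0 := L_neq0 Ly.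
  have d1 : x / y != 1.
    by apply: contra ne_xy => /eqP eq1; rewrite -[x](divfK y0) eq1 mul1r.
  have dN : (x / y) ^+ N = 1 by rewrite expr_div_n !L_unity // divr1.
  by split=> //; apply/esym/Y_unique; rewrite ?divfK.
rewrite (reindex_onto (fun d => (d * Y d, Y d)) (fun z => z.1 / z.2)) /=; last first.
  move=> [x y] /= xy; have [_ _ /= ->] := ratio (x, y) xy.
  by rewrite divfK //; case/andP: xy => /andP[_ /L_neq0].
apply: eq_big => d.
  apply/idP/idP.
    case/andP=> xy /eqP def_d; have [dN d1 _] := ratio (d * Y d, Y d) xy.
    by move: dN d1; rewrite /= def_d => -> ->; rewrite eqxx.
  case/andP=> /eqP dN d1; have /andP[Ly Ldy] := Y_props dN d1.
  have y0 := L_neq0 Ly; rewrite Ly Ldy mulfK // eqxx andbT /=.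
  by rewrite -{2}[Y d]mul1r (inj_eq (mulIf y0)).
by case/andP=> _ /eqP ->.
Qed.

Let card_unity : #|[set w : F | w ^+ N == 1]| = N.
Proof.
have -> : [set w : F | w ^+ N == 1] = [set gamma ^+ (i : 'I_N) | i in 'I_N].
  apply/setP=> w; rewrite inE; apply/eqP/imsetP => [wN | [i _ ->]].
    by have [i ->] := prim_rootP prim_gamma wN; exists i.
  by rewrite exprAC (prim_expr_order prim_gamma) expr1n.
rewrite card_imset ?card_ord // => i j /eqP.
by rewrite (eq_prim_root_expr prim_gamma) !modn_small // => /eqP/val_inj.
Qed.

(** The ordered pairs of distinct elements of L correspond to the p^2 + p
    elements other than 1 of the group. *)
Lemma singer_card : #|L| = p.+1.
Proof.
have := @pair_sum int (fun=> 1); rewrite !sumr_const.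
have -> : #|[pred d : F | (d ^+ N == 1) && (d != 1)]| = (N - 1)%N.
  rewrite -[in RHS]card_unity (cardsD1 1) inE expr1n eqxx add1n subn1 /=.
  by apply: eq_card => d; rewrite !inE andbC.
rewrite -mulrnA -mulrnDr !natz => -[]; rewrite /N addnK; move: #|_| => l eq_l.
have /eqP : (l%:Z - p.+1%:Z) * (l%:Z + p%:Z) = 0.
  transitivity (l%:Z * l%:Z - (l%:Z + (p%:Z ^+ 2 + p%:Z))); first by rewrite -addn1 PoszD; ring.
  by rewrite -PoszM eq_l !PoszD -mulnn PoszM expr2 subrr.
by rewrite mulf_eq0 subr_eq0 => /orP[/eqP[]|] //; lia.
Qed.

Let unit_test : theta_test theta 1 = 1. Proof. exact: theta_test1. Qed.

Let h (w : F) := w ^+ E.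

Let unity_shift a : ((gamma * a) ^+ N == 1) = (a ^+ N == 1).
Proof. by rewrite exprMn (prim_expr_order prim_gamma) mul1r. Qed.

(** By Singer's theorem the double sum is #|L| - 1 plus the sum of the test
    function over the whole group, which is 0. *)
Lemma singer_correlation :
  \sum_(x in L) \sum_(y in L) theta_test theta (h x / h y) = p%:Z.
Proof.
have -> : \sum_(x in L) \sum_(y in L) theta_test theta (h x / h y) =
    \sum_(x in L) \sum_(y in L) theta_test theta (h (x / y)).
  by apply: eq_bigr => x _; apply: eq_bigr => y _; rewrite /h expr_div_n.
rewrite (pair_sum (fun d => theta_test theta (h d))) {1}/h expr1n unit_test singer_card natz.
have := @sum_theta_test0 F (fun d => d ^+ N == 1) h gamma theta gamma_neq0
   (expf_neq0 _ gamma_neq0) unity_shift (fun a _ => exprMn _ _ _).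
rewrite (bigD1 1) ?expr1n //= {1}/h expr1n unit_test.
by move: (\sum_(_ | _) _) => S; lia.
Qed.

(** On the group of norm 1 elements, w s(w)^(p-1) is 1 where s(w) is not 0, since
    w s(w)^p = s(w); hence 1 - w s(w)^(p-1) is the indicator function of L.
    Expanding s(w) = 1 + w (1 + w^p), the sum over the group keeps the terms
    whose exponent is divisible by N, and uniqueness of the digits in base p
    leaves a single one. *)
Lemma singer_sum_inv : \sum_(w in L) (h w)^-1 = - ((-1) ^+ t0 * 'C(t0, f)%:R).
Proof.
have N1 : N%:R = 1 :> F.
  rewrite /N !natrD natrX (_ : p%:R = 0) ?expr0n ?add0r //; exact: (pcharf0 charFp).
have lt_EN : (E < N)%N by rewrite -E7; lia.
have sum_pow k : \sum_(w | w ^+ N == 1) w ^+ k = if (N %| k)%N then 1 else 0 :> F.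
  case: ifPn => [/dvdnP[q ->] | ndvd].
    rewrite (eq_bigr (fun=> 1)) => [|w /eqP wN]; last by rewrite mulnC exprM wN expr1n.
    rewrite sumr_const -[RHS]N1 -[in RHS]card_unity; congr (_ *+ _).
    by apply: eq_card => w; rewrite !inE.
  apply: (sum_exp_subgroup gamma_neq0 unity_shift).
  by rewrite -(prim_order_dvd prim_gamma).
transitivity (\sum_(w | w ^+ N == 1) (1 - w * s w ^+ p.-1) * w ^+ (N - E)).
  rewrite [RHS](bigID (mem L)) /= [X in _ + X]big1 ?addr0 => [|w /andP[/eqP wN]].
    apply: eq_big => w; first by apply/idP/andP => [Lw | []//]; rewrite L_unity ?eqxx.
    move=> Lw; have := Lw; rewrite inE => /eqP ->.
    rewrite expr0n (_ : p.-1 == 0%N = false) ?mulr0 ?subr0 ?mul1r; last by lia.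
    have hw0 : h w != 0 by rewrite expf_neq0 ?L_neq0.
    by apply: (mulfI hw0); rewrite divff // -exprD subnKC ?L_unity // ltnW.
  rewrite inE => sw0; rewrite (_ : w * s w ^+ p.-1 = 1) ?subrr ?mul0r //.
  apply: (mulIf sw0); rewrite mul1r -mulrA -exprSr prednK ?s_frob //.
  exact: ltnW.
have expand w : w * s w ^+ p.-1 * w ^+ (N - E) =
    \sum_(t < p.-1.+1) \sum_(k < t.+1)
       'C(p.-1, t)%:R * 'C(t, k)%:R * w ^+ (N - E + (t + p * k).+1).
  have -> : s w = 1 + w * (1 + w ^+ p) by rewrite /s mulrDr mulr1 -exprS addrA.
  rewrite exprDn mulr_sumr mulr_suml; apply: eq_bigr => t _.
  rewrite expr1n mul1r exprMn exprDn mulr_sumr -mulr_natl !mulr_sumr mulr_suml.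
  apply: eq_bigr => k _; rewrite expr1n mul1r -exprM exprD exprS exprD -mulr_natl.
  by ring.
rewrite (eq_bigr (fun w => w ^+ (N - E) - w * s w ^+ p.-1 * w ^+ (N - E))); last first.
  by move=> w _; rewrite mulrBl mul1r.
rewrite sumrB sum_pow gtnNdvd ?leq_subr ?sub0r; try lia.
rewrite (eq_bigr _ (fun w _ => expand w)) exchange_big /=; congr (- _).
under eq_bigr => t _ do rewrite exchange_big /=.
under eq_bigr => t _ do under eq_bigr => k _ do rewrite -mulr_sumr sum_pow.
have dvd_top (t k : nat) : (t < p.-1.+1)%N -> (k < t.+1)%N ->
    (N %| N - E + (t + p * k).+1)%N = (t == t0) && (k == f).
  move=> lt_t lt_k; have le_pk : (p * k <= p * p.-1)%N by rewrite leq_mul2l; lia.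
  have le_pp : (p * p.-1 + p = p ^ 2)%N.
    by rewrite -mulnSr prednK ?mulnn // ltnW.
  apply/idP/andP => [/dvdnP[q def_q] | [/eqP -> /eqP ->]]; last first.
    by rewrite -def_E subnK // ltnW.
  have q1 : q = 1%N.
    move: def_q le_pk le_pp lt_EN; rewrite /N.
    case: q => [|[|q]] //; first by lia.
    rewrite !mulSn; lia.
  have eq_tk : (k * p + t = f * p + t0)%N by move: def_E def_q lt_EN; rewrite q1 mul1n mulnC; lia.
  have eq_t : t = t0.
    have := congr1 (modn^~ p) eq_tk; rewrite !modnMDl !modn_small //; lia.
  move/eqP: eq_tk; rewrite eq_t eqn_add2r eqn_pmul2r ?eqxx // ltnW //.
have lt_t0 : (t0 < p.-1.+1)%N by lia.
have lt_f : (f < t0.+1)%N by lia.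
rewrite (bigD1 (Ordinal lt_t0)) //= [X in _ + X]big1 ?addr0 => [|t ne_t]; last first.
  apply: big1 => k _; rewrite dvd_top //.
  by case: eqP => [eq_t | _]; rewrite ?mulr0 //; case/eqP: ne_t; apply: val_inj.
rewrite (bigD1 (Ordinal lt_f)) //= [X in _ + X]big1 ?addr0 => [|k ne_k]; last first.
  rewrite dvd_top // eqxx.
  by case: eqP => [eq_k | _]; rewrite ?mulr0 //; case/eqP: ne_k; apply: val_inj.
rewrite dvd_top // !eqxx mulr1 (bin_pred_prime p_prime charFp) //; lia.
Qed.

Lemma singer_periods : exists u w : int,
  [/\ p%:Z = u ^+ 2 + 7 * w ^+ 2, exists v : int, u = p.+1%:Z + 7 * v
    & (-1) ^+ t0 * 'C(t0, f)%:R = 0 :> F \/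
      (-1) ^+ t0 * 'C(t0, f)%:R = - (2 * u)%:~R :> F].
Proof.
have h7 : {in L, forall w, h w ^+ 7 = 1}.
  by move=> w Lw; rewrite /h -exprM E7 L_unity.
have frobL w : w \in L -> w ^+ p \in L.
  rewrite !inE /s => /eqP sw0; apply/eqP.
  rewrite exprAC -[X in X + _ + _](expr1n F p) -!frobD sw0 expr0n gtn_eqF //.
  exact: ltnW.
have h_frob : {in L, forall w, h (w ^+ p) = h w ^+ c}.
  move=> w Lw; rewrite /h exprAC -/(h w) def_p exprD exprM (h7 _ Lw) expr1n mul1r //.
have [u [w [puw [v def_u] sum_h]]] := septic_periods p_odd charFp theta7 h7 c24 frobL
  (fun x y _ _ => @frob_inj x y) h_frob singer_correlation.
exists u, w; split=> //; first by exists v; rewrite -singer_card.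
move: sum_h; rewrite singer_sum_inv => -[/eqP | <-]; last by right; rewrite opprK.
by rewrite oppr_eq0 => /eqP; left.
Qed.
End SingerCase.

(** * Conclusion *)

Lemma legendre7E (a : int) : legendre a 7 =
  if (a %% 7)%Z == 0 then 0
  else if ((a %% 7)%Z \in [:: 1; 2; 4]) then 1 else -1.
Proof.
rewrite /legendre; have -> : (7%:Z %| a)%Z = ((a %% 7)%Z == 0).
  by apply/idP/eqP => /dvdz_mod0P.
case: eqP => // a7; congr (if _ then _ else _).
apply/existsP/idP => [[[z lt_z] /= /eqP]|].
  by rewrite !inE; case: z lt_z => [|[|[|[|[|[|[|z]]]]]]] //= _; lia.
rewrite !inE => /or3P[]/eqP a_mod.
- by exists (inord 1); rewrite inordK // a_mod.
- by exists (inord 3); rewrite inordK // a_mod.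
- by exists (inord 2); rewrite inordK // a_mod.
Qed.

(** -1 is a nonresidue modulo 7. *)
Lemma legendre7_opp (a : int) : legendre a 7 = -1 -> legendre (- a) 7 = 1.
Proof.
rewrite !legendre7E !inE; case: ifP => // a0; case: ifP => // a124 _.
by rewrite ifF ?ifT //; lia.
Qed.

Lemma bin_neq0_pchar (F : fieldType) (p a k : nat) :
  p \in [pchar F] -> (a < p)%N -> (k <= a)%N -> 'C(a, k)%:R != 0 :> F.
Proof.
move=> charFp lt_ap le_ka; have := fact_neq0_pchar charFp lt_ap.
by rewrite -(bin_fact le_ka) natrM mulf_eq0 negb_or => /andP[].
Qed.

(** As a / d need not be in lowest terms, the numerator of the difference is only
    known after multiplication by d, which is prime to p. *)
Lemma eqmodq_fraction (p : nat) (a d z : int) :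
  coprimez p%:Z d -> d != 0 -> (p%:Z %| a - d * z)%Z ->
  eqmodq p (a%:~R / d%:~R) z%:~R.
Proof.
move=> co_pd d_neq0 p_dvd; set r := _ / _.
have dQ : d%:~R != 0 :> rat by rewrite intr_eq0.
have clear_den (q : rat) (b : int) : q * d%:~R = b%:~R -> numq q * d = b * denq q.
  move=> eq_q; apply: (@intr_inj rat); rewrite !rmorphM /= -eq_q [in LHS]numqE.
  by ring.
have r_num : numq r * d = a * denq r by apply: clear_den; rewrite /r divfK.
split.
- apply: coprimez_dvdr co_pd.
  have : (denq r %| numq r * d)%Z by rewrite r_num dvdz_mull.
  by rewrite Gauss_dvdzr // coprimez_sym /coprimez /gcdz (eqP (coprime_num_den r)).
- by rewrite denq_int coprimezE coprimen1.
have J : numq (r - z%:~R) * d = (a - d * z) * denq (r - z%:~R).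
  by apply: clear_den; rewrite mulrBl /r divfK // rmorphB rmorphM /= [z%:~R * _]mulrC.
by rewrite -(Gauss_dvdzl _ co_pd) J dvdz_mulr.
Qed.

(** The number of terms of the sum of roots of unity is p - 2 or p + 1, that is
    6, 3 or 5 modulo 7 for c = 1, 2, 4: always a nonresidue.  The binomial is not
    0 modulo p, its upper entry being less than p, which excludes the first
    alternative of the two period lemmas. *)
Lemma residue_periods (p f c : nat) : prime p -> odd p -> p = (7 * f + c)%N ->
  [|| c == 1, c == 2 | c == 4]%N ->
  exists u w : int, [/\ p%:Z = u ^+ 2 + 7 * w ^+ 2, legendre u 7 = -1
    & (p%:Z %| binomial_residue f c + 2 * u)%Z].
Proof.
move=> p_prime p_odd def_p c124; have p_gt1 := prime_gt1 p_prime.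
have conclude (F : fieldType) (u w r v : int) : p \in [pchar F] ->
    p%:Z = u ^+ 2 + 7 * w ^+ 2 -> u = r + 7 * v -> legendre r 7 = -1 ->
    (binomial_residue f c)%:~R = 0 :> F \/ (binomial_residue f c)%:~R = - (2 * u)%:~R :> F ->
  exists u w : int, [/\ p%:Z = u ^+ 2 + 7 * w ^+ 2, legendre u 7 = -1
    & (p%:Z %| binomial_residue f c + 2 * u)%Z].
  move=> charFp puw def_u leg_r [res0 | res_u].
    exfalso; move/eqP: res0; rewrite binomial_residueE; apply/negP.
    case/or3P: c124 => /eqP -> /=; rewrite ?oppr_eq0;
      by apply: (bin_neq0_pchar charFp); lia.
  exists u, w; split=> //.
    by move: leg_r; rewrite !legendre7E def_u addrC mulrC modzMDl.
  by rewrite -(intr_eq0_pchar charFp) rmorphD /= res_u addNr.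
have [c1 | c_neq1] := eqVneq c 1%N.
  have [g prim_g] := finField_prim_root 'F_p.
  have charFp := pchar_Fp p_prime.
  rewrite c1 in def_p.
  have [u [w [puw [v def_u] val]]] := split_periods p_odd charFp (card_Fp p_prime) def_p prim_g.
  apply: (conclude _ u w 6 v charFp) => //; first by rewrite legendre7E.
  by rewrite binomial_residueE c1.
have [F charFp cardF] := PrimePowerField p_prime (isT : 0 < 3)%N.
(* The base p expansion of (p^2 + p + 1) / 7 - 1 is t0 + p f. *)
pose t0 := (if c == 2 then 3 * f else 5 * f + 2)%N.
have c24 : c = 2 \/ c = 4 by move: c124; rewrite (negPf c_neq1) /= => /orP[]/eqP ->; [left | right].
have N7 : ((p ^ 2 + p + 1) = (t0 + p * f).+1 * 7)%N.
  by rewrite /t0 def_p; case: c24 => -> /=; ring.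
have def_E : ((p ^ 2 + p + 1) %/ 7 = (t0 + p * f).+1)%N by rewrite N7 mulnK.
have t0_lt : (f <= t0 < p)%N by rewrite /t0; case: c24 def_p => -> /=; lia.
have [g prim_g] := finField_prim_root F.
have q1 : (#|F|.-1 = (p ^ 2 + p + 1) * p.-1)%N.
  have cube q : ((q + 1) ^ 3 = ((q + 1) ^ 2 + (q + 1) + 1) * q + 1)%N by ring.
  have := cube p.-1; rewrite !(addn1 p.-1) (prednK (ltnW p_gt1)) -cardF => ->.
  by rewrite addn1.
have /(dvdn_prim_root prim_g) prim_gamma : (p ^ 2 + p + 1 %| #|F|.-1)%N by rewrite q1 dvdn_mulr.
have [u [w [puw [v def_u] val]]] := singer_periods p_odd charFp def_p c24 def_E t0_lt prim_gamma.
have res : (binomial_residue f c)%:~R = (-1) ^+ t0 * 'C(t0, f)%:R :> F.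
  rewrite binomial_residueE /t0; case: c24 def_p => -> def_p /=.
    by rewrite -signr_odd (_ : odd (3 * f) = true) ?expr1 ?mulN1r //; lia.
  rewrite -signr_odd (_ : odd (5 * f + 2) = true) ?expr1 ?mulN1r; last by lia.
  rewrite (bin_reflect (a := 5 * f + 2) (b := (3 * f).+1) charFp); last 2 first.
  - by lia.
  - have -> : (5 * f + 2 + (3 * f).+1).+1 = (p + f)%N by lia.
    by rewrite natrD (pcharf0 charFp) add0r.
  by rewrite -signr_odd (_ : odd f = true) ?expr1 ?mulN1r ?opprK //; lia.
rewrite -res in val.
case: c24 => c_eq.
  by apply: (conclude F u w 3 (v + f%:Z) charFp puw); rewrite ?legendre7E //; lia.
by apply: (conclude F u w 5 (v + f%:Z) charFp puw); rewrite ?legendre7E //; lia.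
Qed.

Theorem corollary5p7 (p : nat) (p_prime : prime p) (p_odd : odd p) :
  let S : rat := \sum_(0 <= k < ((p - 1) %/ 2).+1)
    'C(2 * k, k)%:R * (trinomial (2 * k) 12 (-7))%:~R / 16%:R ^+ k in
  (legendre p%:Z 7 = 1 ->
     forall x y : int, p%:Z = x ^+ 2 + 7 * y ^+ 2 ->
       eqmodq p S (2 * x * legendre x 7)%:~R)
  /\ (legendre p%:Z 7 = -1 -> eqmodq p S 0).
Proof.
move=> S; have p_gt1 := prime_gt1 p_prime.
pose n := p./2; pose f := (p %/ 7)%N; pose c := (p %% 7)%N.
have def_n : p = n.*2.+1 by rewrite -[LHS]odd_double_half p_odd.
have def_p : p = (7 * f + c)%N by rewrite mulnC -divn_eq.
have charFp := pchar_Fp p_prime.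
pose a : int := \sum_(k < n.+1) 'C(k.*2, k)%:Z * trinomial k.*2 12 (-7) * 16 ^+ (n - k).
pose d : int := 16 ^+ n.
have split16 (R : comNzRingType) (k : nat) : (k <= n)%N -> 16%:R ^+ n = 16%:R ^+ (n - k) * 16%:R ^+ k :> R.
  by move=> le_kn; rewrite -exprD subnK.
have def_S : S = a%:~R / d%:~R.
  have n16 : 16%:R != 0 :> rat by [].
  rewrite /S (_ : (p - 1) %/ 2 = n)%N; last by lia.
  rewrite big_mkord [a%:~R]rmorph_sum mulr_suml; apply: eq_bigr => k _.
  have le_kn : (k <= n)%N by rewrite -ltnS.
  rewrite mul2n /d !rmorphM !rmorphXn /= -pmulrn -[16%:~R]/(16%:R) (split16 _ k le_kn).
  by field; rewrite expf_neq0 // expf_neq0.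
have n16 : 16%:R != 0 :> 'F_p.
  rewrite (natr_eq0_pchar charFp) (_ : 16 = 2 ^ 4)%N // Euclid_dvdX // andbT.
  by rewrite dvdn_prime2 //; apply: contraTneq p_odd => ->.
have co_pd : coprimez p%:Z d.
  rewrite coprimezE abszX coprimeXr // prime_coprime //.
  by rewrite -(natr_eq0_pchar charFp).
have d_neq0 : d != 0 by rewrite expf_neq0.
have a_mod : (0 < c)%N -> a%:~R = d%:~R * (binomial_residue f c)%:~R :> 'F_p.
  move=> c_gt0; rewrite -(hasse_value p_prime charFp p_odd def_p); last first.
    by rewrite c_gt0 ltn_mod.
  have -> : p.-1 = n.*2 by lia.
  rewrite -(trinomial_sum_coef p_prime charFp def_n) mulr_sumr [a%:~R]rmorph_sum.
  apply: eq_bigr => k _; have le_kn : (k <= n)%N by rewrite -ltnS.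
  rewrite /d !rmorphM !rmorphXn /= -pmulrn -[16%:~R]/(16%:R) (split16 _ k le_kn).
  by field; rewrite expf_neq0.
have reduce (z : int) : (0 < c)%N -> (p%:Z %| binomial_residue f c - z)%Z -> eqmodq p S z%:~R.
  move=> c_gt0 res_z; rewrite def_S; apply: eqmodq_fraction => //.
  rewrite -(intr_eq0_pchar charFp) rmorphB rmorphM /= a_mod // -mulrBr -rmorphB.
  by rewrite mulf_eq0 (intr_eq0_pchar charFp) (intr_eq0_pchar charFp) res_z orbT.
rewrite legendre7E.
have mod7 : (p%:Z %% 7)%Z = c%:Z by rewrite modz_nat.
rewrite mod7; split; case: ifP => // c_neq0; case: ifP => // c124 _.
  move=> x y pxy.
  have c124' : [|| c == 1, c == 2 | c == 4]%N by move: c124; rewrite !inE.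
  have [u [w [puw leg_u res_u]]] := residue_periods p_prime p_odd def_p c124'.
  apply: reduce; first by lia.
  suff -> : 2 * x * legendre x 7 = - (2 * u) by rewrite opprK.
  have [eq_ux | eq_ux] := form7_unique p_prime puw pxy.
    by rewrite -eq_ux leg_u mulrN1.
  have -> : x = - u by rewrite eq_ux opprK.
  have -> : legendre (- u) 7 = 1.
    exact: legendre7_opp.
  by rewrite mulr1 mulrN.
have := reduce 0; apply; first by lia.
suff -> : binomial_residue f c = 0 by rewrite subrr dvdz0.
move: c124; rewrite /binomial_residue !inE => /norP[/negPf c1 /norP[/negPf c2 /negPf c4]].
by move: c1 c2 c4; rewrite !eqz_nat => -> -> ->.
Qed.
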